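(* Let $(M,g,J,F)$ be an almost Hermitian $4$-manifold (not necessarily compact) and let $p\in M$. The holomorphic sectional curvature with respect to the Hermitian connection is constant at $p$ (i.e. there is a real number $k$ with $H(Z)=k$ for all nonzero $Z\in T^{1,0}_pM$) if and only if, at the point $p$, both (i) $W^-=0$, and (ii) $\ast\rho=r$.
   Context: An almost Hermitian $4$-manifold $(M,g,J,F)$ is a smooth $4$-manifold with an almost complex structure $J$, a Riemannian metric $g$ for which $J$ is orthogonal, and $F=g(J\cdot,\cdot)$. $M$ is oriented by $F^2/2$, $\ast$ is the (complex linearly extended) Hodge operator on $2$-forms, and $W^-$ is the anti-self-dual part of the Weyl curvature of $g$. With $D^g$ the Levi-Civita connection, the (first canonical) Hermitian connection is $\nabla_XY=D^g_XY-\tfrac12J(D^g_XJ)Y$, with curvature $R^\nabla_{XYZW}=g([\nabla_X,\nabla_Y]Z-\nabla_{[X,Y]}Z,W)$. All tensors are extended complex multilinearly to $TM\otimes\mathbb{C}=T^{1,0}M\oplus T^{0,1}M$, and $h(Z,W)=g(Z,\bar W)$. For nonzero $Z\in T^{1,0}M$ put $H(Z)=\dfrac{R^\nabla_{Z,\bar Z,Z,\bar Z}}{h(Z,Z)^2}$; equivalently, $H(X)=-R^\nabla_{X,JX,X,JX}$ for unit real tangent vectors $X$. Let $(z_1,z_2)$ be a local $h$-orthonormal frame of $T^{1,0}M$ with dual coframe $(z^1,z^2)$, so $F=i(z^1\wedge\bar z^{1}+z^2\wedge\bar z^{2})$. The two Ricci forms are $$\rho=i\sum_{\alpha,\beta,\gamma}R^\nabla(z_\alpha,\bar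 z_\beta,z_\gamma,\bar z_\gamma)\,z^\alpha\wedge\bar z^\beta,\qquad r=i\sum_{\gamma,\lambda,\mu}R^\nabla(z_\gamma,\bar z_\gamma,z_\lambda,\bar z_\mu)\,z^\lambda\wedge\bar z^\mu .$$ *)

(* Defs.v *)
From HB Require Import structures.
From mathcomp Require Import all_boot all_order all_algebra.
From mathcomp Require Import complex.
From mathcomp Require Import all_classical all_reals all_analysis.

Set Implicit Arguments.
Unset Strict Implicit.
Unset Printing Implicit Defensive.

Import Order.TTheory GRing.Theory Num.Theory.
Import numFieldNormedType.Exports.

Local Open Scope classical_set_scope.
Local Open Scope complex_scope.
Local Open Scope ring_scope.

(* Points of a coordinate domain and tangent vectors are column vectors.      *)

Section Calculus.
Variables (R : realType) (n : nat).
Implicit Types (U : set 'cV[R]_n) (f : 'cV[R]_n -> R).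

Definition basis_vec (j : 'I_n) : 'cV[R]_n := delta_mx j 0.

Definition partial (j : 'I_n) f : 'cV[R]_n -> R :=
  fun x => 'D_(basis_vec j) f x.

Fixpoint Ck (k : nat) U f : Prop :=
  {within U, continuous f} /\
  match k with
  | 0 => True
  | k'.+1 => forall j : 'I_n,
      (forall x, U x -> derivable f x (basis_vec j)) /\ Ck k' U (partial j f)
  end.

(* Only used on open sets U. *)
Definition smooth_on U f : Prop := forall k, Ck k U f.

Definition smooth_mx_on (m1 m2 : nat) U (A : 'cV[R]_n -> 'M[R]_(m1, m2)) :=
  forall a b, smooth_on U (fun x => A x a b).

Definition jacobian_mx (phi : 'cV[R]_n -> 'cV[R]_n) (x : 'cV[R]_n) : 'M[R]_n :=
  \matrix_(k, j) partial j (fun y => phi y k 0) x.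

End Calculus.

(* A smooth n-manifold, given by a (not necessarily maximal) smooth atlas.    *)
(* [chart_map i] and [chart_inv i] are meaningful only on [chart_dom i] and on its image.   *)
Record smooth_manifold (R : realType) (n : nat) := SmoothManifold {
  carrier :> topologicalType;
  manifold_hausdorff : hausdorff_space carrier;
  manifold_second_countable : @second_countable carrier;
  chart : Type;
  chart_dom : chart -> set carrier;
  chart_map : chart -> carrier -> 'cV[R]_n;
  chart_inv : chart -> 'cV[R]_n -> carrier;
  chart_dom_open : forall i, open (chart_dom i);
  chart_dom_cover : forall p, exists i, chart_dom i p;
  chart_image_open : forall i, open (chart_map i @` chart_dom i);
  chart_mapK : forall i p, chart_dom i p -> chart_inv i (chart_map i p) = p;
  chart_map_continuous : forall i, {within chart_dom i, continuous (chart_map i)};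
  chart_inv_continuous :
    forall i, {within chart_map i @` chart_dom i, continuous (chart_inv i)};
  transition_smooth : forall i j,
    smooth_mx_on (chart_map i @` (chart_dom i `&` chart_dom j)) (chart_map j \o chart_inv i) }.

(* A tensor field is a family of component functions, one for each chart,     *)
(* obeying the transformation rule on overlaps: (X, Y) |-> X^T *m g *m Y is   *)
(* the metric and X |-> J *m X the almost complex structure.                  *)
Record almost_hermitian (R : realType) (n : nat) (M : smooth_manifold R n) :=
  AlmostHermitian {
  metric : chart M -> 'cV[R]_n -> 'M[R]_n;
  acs : chart M -> 'cV[R]_n -> 'M[R]_n;
  metric_smooth : forall i, smooth_mx_on (chart_map i @` chart_dom i) (metric i);
  acs_smooth : forall i, smooth_mx_on (chart_map i @` chart_dom i) (acs i);
  metric_transition : forall i j p, chart_dom i p -> chart_dom j p ->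
    let A := jacobian_mx (chart_map j \o chart_inv i) (chart_map i p) in
    metric i (chart_map i p) = A^T *m metric j (chart_map j p) *m A;
  acs_transition : forall i j p, chart_dom i p -> chart_dom j p ->
    let A := jacobian_mx (chart_map j \o chart_inv i) (chart_map i p) in
    A *m acs i (chart_map i p) = acs j (chart_map j p) *m A;
  metric_sym : forall i p, chart_dom i p ->
    (metric i (chart_map i p))^T = metric i (chart_map i p);
  metric_pos : forall i p, chart_dom i p -> forall X : 'cV[R]_n, X != 0 ->
    0 < (X^T *m metric i (chart_map i p) *m X) 0 0;
  acs_sqr : forall i p, chart_dom i p ->
    acs i (chart_map i p) *m acs i (chart_map i p) = - 1%:M;
  acs_orthogonal : forall i p, chart_dom i p ->
    (acs i (chart_map i p))^T *m metric i (chart_map i p) *m acs i (chart_map i p)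
    = metric i (chart_map i p) }.

Section Connections.
Variables (R : realType) (n : nat).

Notation field := ('cV[R]_n -> 'cV[R]_n).

Implicit Types (g J : 'cV[R]_n -> 'M[R]_n) (X Y Z : field).

Definition deriv_along X Y : field :=
  fun x => \col_k \sum_i X x i 0 * partial i (fun y => Y y k 0) x.

Definition lie_bracket X Y : field :=
  fun x => deriv_along X Y x - deriv_along Y X x.

(* christoffel g k i j = Gamma^k_{ij} *)
Definition christoffel g (k i j : 'I_n) : 'cV[R]_n -> R := fun x =>
  2^-1 * \sum_l invmx (g x) k l *
    (partial i (fun y => g y j l) x + partial j (fun y => g y i l) x
     - partial l (fun y => g y i j) x).

Definition levi_civita g X Y : field := fun x =>
  deriv_along X Y x
  + \col_k \sum_i \sum_j christoffel g k i j x * X x i 0 * Y x j 0.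

(* (D^g_X J) Y *)
Definition levi_civita_acs g J X Y : field := fun x =>
  levi_civita g X (fun y => J y *m Y y) x - J x *m levi_civita g X Y x.

Definition hermitian_connection g J X Y : field := fun x =>
  levi_civita g X Y x - 2^-1 *: (J x *m levi_civita_acs g J X Y x).

Definition curvature (nabla : field -> field -> field) X Y Z : field := fun x =>
  nabla X (nabla Y Z) x - nabla Y (nabla X Z) x - nabla (lie_bracket X Y) Z x.

(* R_{ijkl} = g(R(e_i, e_j) e_k, e_l) at x, for the coordinate frame (e_i). *)
Definition curvature_tensor (nabla : field -> field -> field) g
    (x : 'cV[R]_n) (i j k l : 'I_n) : R :=
  let e a : field := fun=> basis_vec R a in
  ((curvature nabla (e i) (e j) (e k) x)^T *m g x *m e l x) 0 0.

End Connections.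

Section Forms.
Variable K : fieldType.

(* A 2-form is the skew matrix of its components phi(e_i, e_j), and a 1-form  *)
(* is a row vector; (a /\ b)(X, Y) = a(X) b(Y) - a(Y) b(X).                   *)
Definition wedge11 (n : nat) (a b : 'rV[K]_n) : 'M[K]_n :=
  a^T *m b - b^T *m a.

Definition wedge22 (n : nat) (a b : 'M[K]_n) (i j k l : 'I_n) : K :=
  a i j * b k l - a i k * b j l + a i l * b j k
  + a j k * b i l - a j l * b i k + a k l * b i j.

(* F = g(J . , . ) *)
Definition fundamental_form (n : nat) (g J : 'M[K]_n) : 'M[K]_n := J^T *m g.

(* The volume form F^2 / 2 of an almost Hermitian 4-manifold. *)
Definition volume_form (g J : 'M[K]_4) (i j k l : 'I_4) : K :=
  2^-1 * wedge22 (fundamental_form g J) (fundamental_form g J) i j k l.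

(* ( * b)_{kl} = 1/2 b^{ij} vol_{ijkl}, the indices of b being raised by g;   *)
(* thus a /\ * b = <a, b> vol, with <a, b> = 1/2 a_{ij} b^{ij}.               *)
Definition hodge (g J b : 'M[K]_4) : 'M[K]_4 :=
  let bup := invmx g *m b *m (invmx g)^T in
  \matrix_(k, l) (2^-1 * \sum_i \sum_j bup i j * volume_form g J i j k l).

End Forms.

Section Weyl.
Variable R : realType.

(* With the convention R_{XYZW} = g(R(X, Y) Z, W), the trace over the first   *)
(* and last slots is the Ricci tensor that is positive on round spheres.      *)
Definition ricci (n : nat) (g : 'M[R]_n) (Rm : 'I_n -> 'I_n -> 'I_n -> 'I_n -> R)
    (j k : 'I_n) : R :=
  \sum_i \sum_l invmx g i l * Rm i j k l.

Definition scalar_curvature (n : nat) (g : 'M[R]_n)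
    (Rm : 'I_n -> 'I_n -> 'I_n -> 'I_n -> R) : R :=
  \sum_j \sum_k invmx g j k * ricci g Rm j k.

(* The Schouten tensor 1 / (n - 2) (Ric - s / (2 (n - 1)) g), for n = 4. *)
Definition schouten (g : 'M[R]_4) (Rm : 'I_4 -> 'I_4 -> 'I_4 -> 'I_4 -> R)
    (j k : 'I_4) : R :=
  2^-1 * (ricci g Rm j k - scalar_curvature g Rm / 6%:R * g j k).

Definition weyl (g : 'M[R]_4) (Rm : 'I_4 -> 'I_4 -> 'I_4 -> 'I_4 -> R)
    (i j k l : 'I_4) : R :=
  let P := schouten g Rm in
  Rm i j k l - (P i l * g j k + P j k * g i l - P i k * g j l - P j l * g i k).

(* The anti-self-dual part (W - * W) / 2; * acts on the first pair of slots. *)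
Definition weyl_minus (g J : 'M[R]_4)
    (Rm : 'I_4 -> 'I_4 -> 'I_4 -> 'I_4 -> R) (i j k l : 'I_4) : R :=
  let W := weyl g Rm in
  2^-1 * (W i j k l - hodge g J (\matrix_(a, b) W a b k l) i j).

End Weyl.

Section Complexification.
Variables (R : realType) (n : nat).
Local Notation C := R[i].
Implicit Types (g J : 'M[R]_n) (Rm : 'I_n -> 'I_n -> 'I_n -> 'I_n -> R).

Definition cplx_mx (m1 m2 : nat) (A : 'M[R]_(m1, m2)) : 'M[C]_(m1, m2) :=
  map_mx (real_complex R) A.

Definition conj_mx (m1 m2 : nat) (A : 'M[C]_(m1, m2)) : 'M[C]_(m1, m2) :=
  map_mx (@conjc R) A.

Definition cplx_tensor Rm (Z1 Z2 Z3 Z4 : 'cV[C]_n) : C :=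
  \sum_i \sum_j \sum_k \sum_l
    (Rm i j k l)%:C * Z1 i 0 * Z2 j 0 * Z3 k 0 * Z4 l 0.

Definition T10 J (Z : 'cV[C]_n) : Prop := cplx_mx J *m Z = 'i%C *: Z.

Definition herm g (Z W : 'cV[C]_n) : C :=
  (Z^T *m cplx_mx g *m conj_mx W) 0 0.

Definition hol_sec_curv g Rm (Z : 'cV[C]_n) : C :=
  cplx_tensor Rm Z (conj_mx Z) Z (conj_mx Z) / herm g Z Z ^+ 2.

Definition constant_hol_sec_curv g J Rm : Prop :=
  exists k : R, forall Z : 'cV[C]_n,
    T10 J Z -> Z != 0 -> hol_sec_curv g Rm Z = k%:C.

Definition unitary_frame (m : nat) g J (z : 'I_m -> 'cV[C]_n) : Prop :=
  (forall a, T10 J (z a)) /\ (forall a b, herm g (z a) (z b) = (a == b)%:R).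

(* The 1-forms z^a dual to z_a in the coframe dual to (z_a, conj z_a). *)
Definition dual_coframe (m : nat) (z : 'I_m -> 'cV[C]_n)
    (zeta : 'I_m -> 'rV[C]_n) : Prop :=
  forall a b, (zeta a *m z b) 0 0 = (a == b)%:R /\
              (zeta a *m conj_mx (z b)) 0 0 = 0.

Definition ricci_rho (m : nat) Rm (z : 'I_m -> 'cV[C]_n)
    (zeta : 'I_m -> 'rV[C]_n) : 'M[C]_n :=
  'i%C *: \sum_a \sum_b \sum_c
    cplx_tensor Rm (z a) (conj_mx (z b)) (z c) (conj_mx (z c))
      *: wedge11 (zeta a) (conj_mx (zeta b)).

Definition ricci_r (m : nat) Rm (z : 'I_m -> 'cV[C]_n)
    (zeta : 'I_m -> 'rV[C]_n) : 'M[C]_n :=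
  'i%C *: \sum_c \sum_l \sum_u
    cplx_tensor Rm (z c) (conj_mx (z c)) (z l) (conj_mx (z u))
      *: wedge11 (zeta l) (conj_mx (zeta u)).

End Complexification.

(* Main.v *)
Require Import Defs.
From HB Require Import structures.
From mathcomp Require Import all_boot all_order all_algebra.
From mathcomp Require Import complex.
From mathcomp Require Import all_classical all_reals all_analysis.
From mathcomp Require Import ring lra.

(** Write nabla = D + A with A_X = -1/2 J (D_X J). The endomorphism A_X is skew
and anticommutes with J, hence belongs to a bundle of rank 2 contained in the
self-dual forms. Consequently the curvature R' of nabla differs from the Riemann
tensor R, as a 2-form with values in endomorphisms, by self-dual endomorphisms
only. The component from T10 to T10 of such an endomorphism is a scalar:
R'(X, Y, Z, conj W) = R(X, Y, Z, conj W) + kappa(X, Y) h(Z, W) for Z, W in T10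
([hermitian_curvatureE], [curvature_difference_scalar]). Of the covariant
derivative of A, which occurs in R' - R, this component only sees the part that
commutes with J, and that part is found by differentiating A J + J A = 0
([covariant_contorsion_acs]).

For a unit vector Z of T10, the bivector Z /\ conj Z is, up to a factor, F plus a
vector psi of fixed length in the 3-dimensional space of anti-self-dual forms, and
psi runs through the whole sphere. So the holomorphic sectional curvature at a
point is a quadratic function of psi. It is constant exactly when its linear part
and the trace-free part of its quadratic part vanish. The quadratic part comes
from the anti-self-dual block of R, as kappa only contributes in the direction of
F in the last two slots; its trace-free part is W^-. The linear part is
R'(F, psi) + R'(psi, F), and its vanishing says that the anti-self-dual parts of
r and rho are opposite, that is * rho = r, the components along F being equal in
any case.

The proof carries this out in the components of a unitary frame z_1, z_2. The
three conditions become linear equations on the components of R and R'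
([constant_hol_sec_curvP]; [weyl_minus_eq0] with [frame_weyl_eq0];
[hodge_ricciP]), which are compared by means of kappa and the symmetries of the
Riemann tensor ([pointwise_equivalence]). These symmetries are obtained in
coordinates from the equality of mixed partial derivatives of the metric
([derive_comm], [levi_civita_riemann_symmetric]). *)

Set Implicit Arguments.
Unset Strict Implicit.
Unset Printing Implicit Defensive.

Import Order.TTheory GRing.Theory Num.Theory.
Import numFieldNormedType.Exports.

Local Open Scope classical_set_scope.
Local Open Scope complex_scope.
Local Open Scope ring_scope.

(** * Symmetry of second derivatives *)

Section Schwarz.
Variables (R : realType) (V : normedModType R).
Implicit Types (f : V -> R) (a u v : V).

(** Reduces directional derivatives on a normed module to one real variable,
where the mean value theorem is available. *)
Lemma is_derive_line f a v (s : R) : derivable f (a + s *: v) v ->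
  is_derive s (1 : R) (fun t : R => f (a + t *: v)) ('D_v f (a + s *: v)).
Proof.
move=> df.
have E : (fun h : R => h^-1 *: ((fun t : R => f (a + t *: v)) (h *: (1 : R) + s)
      - f (a + s *: v))) =
   (fun h : R => h^-1 *: (f (h *: v + (a + s *: v)) - f (a + s *: v))).
  apply/funext => h; rewrite -[h *: (1 : R)]/(h * 1) mulr1.
  by congr (_ *: (f _ - _)); rewrite scalerDl addrCA.
by split; [move: df; rewrite /derivable /= -E | rewrite /derive /= -E].
Qed.

Lemma MVT_line f a v (h : R) : 0 < h ->
  (forall s, 0 <= s <= h -> derivable f (a + s *: v) v) ->
  exists2 s, 0 <= s <= h & f (a + h *: v) - f a = h * 'D_v f (a + s *: v).
Proof.
move=> h0 df.
have dl s : s \in `[0, h] -> is_derive s (1 : R) (fun t : R => f (a + t *: v))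
    ('D_v f (a + s *: v)).
  by rewrite in_itv /= => sh; apply: is_derive_line; apply: df.
pose F (t : R) := f (a + t *: v); pose dF (t : R) := 'D_v f (a + t *: v).
have dF' s : s \in `]0, h[ -> is_derive s (1 : R) F (dF s).
  by move=> sI; apply: dl; apply: subset_itv_oo_cc sI.
have cF : {within `[0, h], continuous F}.
  by apply: derivable_within_continuous => s /dl [].
have [s sI E] := MVT_segment (ltW h0) dF' cF.
exists s; first by move: sI; rewrite in_itv.
by move: E; rewrite /F /dF scale0r addr0 subr0 mulrC.
Qed.

(** The mean value theorem applied first along [u] to the increment of [f] in
the direction [v], then along [v] to ['D_u f]. The left-hand side is symmetric
in [u] and [v], which is what makes mixed derivatives commute. *)
Lemma second_difference f a u v (h : R) : 0 < h ->
  (forall s t, 0 <= s <= h -> 0 <= t <= h ->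
     derivable f (a + s *: u + t *: v) u /\
     derivable ('D_u f) (a + s *: u + t *: v) v) ->
  exists s t, [/\ 0 <= s <= h, 0 <= t <= h &
    f (a + h *: u + h *: v) - f (a + h *: u) - (f (a + h *: v) - f a)
    = h ^+ 2 * 'D_v ('D_u f) (a + s *: u + t *: v)].
Proof.
move=> h0 df.
have hh : 0 <= h <= h by rewrite lexx ltW.
have h00 : 0 <= (0 : R) <= h by rewrite lexx ltW.
pose F x := f (x + h *: v) - f x.
have sh w (c : V) : derivable f (w + c) u ->
    is_derive w u (fun x => f (x + c)) ('D_u f (w + c)).
  move=> dfw.
  have E : (fun t : R => t^-1 *: (f (t *: u + w + c) - f (w + c))) =
           (fun t : R => t^-1 *: (f (t *: u + (w + c)) - f (w + c))).
    by apply/funext => t; rewrite addrA.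
  by split; [move: dfw; rewrite /derivable /= -E | rewrite /derive /= -E].
have dF s : 0 <= s <= h -> is_derive (a + s *: u) u F
    ('D_u f (a + s *: u + h *: v) - 'D_u f (a + s *: u)).
  move=> sI; have [d1 _] := df s h sI hh; have [d0 _] := df s 0 sI h00.
  apply: is_deriveB; first exact: sh.
  by apply: derivableP; move: d0; rewrite scale0r addr0.
have [s sI Es] := MVT_line h0 (fun s sI => @ex_derive _ _ _ _ _ _ _ (dF s sI)).
have [t tI Et] := MVT_line h0 (fun t tI => (df s t sI tI).2).
exists s, t; split=> //.
rewrite -/(F _) -/(F _) Es (@derive_val _ _ _ _ _ _ _ (dF s sI)) Et.
by rewrite mulrA expr2.
Qed.

(** Both mixed derivatives are values, at points near [x], of the same second
difference divided by [h ^+ 2]; continuity at [x] brings them together. *)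
Lemma derive_comm f u v x (U : set V) : open U -> U x ->
  (forall y, U y -> derivable f y u) -> (forall y, U y -> derivable f y v) ->
  (forall y, U y -> derivable ('D_u f) y v) ->
  (forall y, U y -> derivable ('D_v f) y u) ->
  {for x, continuous ('D_v ('D_u f))} -> {for x, continuous ('D_u ('D_v f))} ->
  'D_v ('D_u f) x = 'D_u ('D_v f) x.
Proof.
move=> oU Ux du dv duv dvu cP cQ.
set P := 'D_v ('D_u f) in cP *; set Q := 'D_u ('D_v f) in cQ *.
apply/eqP; rewrite -subr_eq0 -normr_eq0; apply: contraT => neq0.
(* Within [e] of [x] the two derivatives stay apart; [h] keeps the whole
   parallelogram spanned by [h *: u] and [h *: v] inside that ball. *)
set e := `|P x - Q x| / 2.
have e0 : 0 < e by rewrite divr_gt0 // lt_neqAle eq_sym neq0 normr_ge0.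
have nU : nbhs x U by apply: open_nbhs_nbhs.
have nP : \forall y \near x, `|P x - P y| < e by move/cvgrPdist_lt: cP; apply.
have nQ : \forall y \near x, `|Q x - Q y| < e by move/cvgrPdist_lt: cQ; apply.
have [d /= d0 sub] := (nbhs_ballP _ _).1 (filterI nU (filterI nP nQ)).
set h := d / (`|u| + `|v| + 1).
have n0 : 0 < `|u| + `|v| + 1.
  by rewrite ltr_wpDl // addr_ge0.
have h0 : 0 < h by rewrite divr_gt0.
have near_x s t : 0 <= s <= h -> 0 <= t <= h ->
  [/\ U (x + s *: u + t *: v), `|P x - P (x + s *: u + t *: v)| < e &
      `|Q x - Q (x + s *: u + t *: v)| < e].
  move=> /andP[s0 sh] /andP[t0 th]; have [] // := sub (x + s *: u + t *: v).
    rewrite -ball_normE /= -addrA opprD addNKr normrN.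
    apply: le_lt_trans (ler_normD _ _) _; rewrite !normrZ !ger0_norm //.
    apply: (@le_lt_trans _ _ (h * (`|u| + `|v|))).
      by rewrite mulrDr lerD // ler_wpM2r.
    by rewrite /h -mulrA gtr_pMr // mulrC ltr_pdivrMr // mul1r ltrDl.
  by move=> ? [].
have duP s t : 0 <= s <= h -> 0 <= t <= h ->
    derivable f (x + s *: u + t *: v) u /\
    derivable ('D_u f) (x + s *: u + t *: v) v.
  by move=> sI tI; have [Us _ _] := near_x s t sI tI; split; [exact: du | exact: duv].
have dvP t s : 0 <= t <= h -> 0 <= s <= h ->
    derivable f (x + t *: v + s *: u) v /\
    derivable ('D_v f) (x + t *: v + s *: u) u.
  move=> tI sI; rewrite addrAC; have [Us _ _] := near_x s t sI tI.
  by split; [exact: dv | exact: dvu].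
have [s [t [sI tI E1]]] := second_difference h0 duP.
have [t' [s' [tI' sI' E2]]] := second_difference h0 dvP.
have EPQ : P (x + s *: u + t *: v) = Q (x + s' *: u + t' *: v).
  apply: (@mulfI _ (h ^+ 2)); first by rewrite expf_neq0 // gt_eqF.
  apply: (etrans (esym E1)); rewrite [x + s' *: u + _]addrAC; apply: etrans E2.
  by rewrite [x + h *: v + _]addrAC; ring.
have [_ Px _] := near_x s t sI tI; have [_ _ Qx] := near_x s' t' sI' tI'.
have : `|P x - Q x| < e + e.
  apply: le_lt_trans (ltrD Px Qx).
  rewrite -EPQ [X in _ <= _ + X]distrC.
  by apply: le_trans (ler_normD _ _); rewrite subrKA.
by rewrite /e -splitr ltxx.
Qed.

End Schwarz.

(** * Derivatives of matrix-valued functions *)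

Section MatrixCalculus.
Variables (R : realType) (V : normedModType R).
Implicit Types (x v : V).

Lemma derivable_bigsum (I : Type) (r : seq I) (F : I -> V -> R) x v :
  (forall i, derivable (F i) x v) ->
  derivable (fun y => \sum_(i <- r) F i y) x v.
Proof.
move=> dF; elim: r => [|i r IH].
  by under eq_fun do rewrite big_nil; apply: derivable_cst.
by under eq_fun do rewrite big_cons; apply: derivableD.
Qed.

Lemma derivable_bigprod (I : Type) (r : seq I) (F : I -> V -> R) x v :
  (forall i, derivable (F i) x v) ->
  derivable (fun y => \prod_(i <- r) F i y) x v.
Proof.
move=> dF; elim: r => [|i r IH].
  by under eq_fun do rewrite big_nil; apply: derivable_cst.
by under eq_fun do rewrite big_cons; apply: derivableM.
Qed.

Lemma derivable_det n (A : V -> 'M[R]_n) x v :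
  (forall i j, derivable (fun y => A y i j) x v) ->
  derivable (fun y => \det (A y)) x v.
Proof.
move=> dA; apply: derivable_bigsum => s.
by apply: derivableM; [apply: derivable_cst | apply: derivable_bigprod].
Qed.

(** By Cramer's rule the inverse is the adjugate over the determinant, and
both are polynomial in the entries. *)
Lemma derivable_invmx n (A : V -> 'M[R]_n) x v :
  derivable A x v -> (\forall y \near x, A y \in unitmx) ->
  derivable (fun y => invmx (A y)) x v.
Proof.
move=> /derivable_mxP dA uA.
apply: (@near_eq_derivable _ _ _ (fun y => (\det (A y))^-1 *: \adj (A y))).
  by near=> y; rewrite /invmx ifT //; near: y.
apply/derivable_mxP => i j; under eq_fun do rewrite !mxE.
apply: derivableM.
  apply: derivableV; last exact: derivable_det.
  by rewrite -unitfE -unitmxE; apply: nbhs_singleton uA.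
apply: derivableM; first exact: derivable_cst.
apply: derivable_det => a b; under eq_fun do rewrite !mxE; exact: dA.
Unshelve. all: by end_near. Qed.

Lemma is_derive_mxP m n (A : V -> 'M[R]_(m, n)) (A' : 'M[R]_(m, n)) x v :
  is_derive x v A A' <-> forall i j, is_derive x v (fun y => A y i j) (A' i j).
Proof.
split=> [[dA <-] i j | dA].
  by rewrite derive_mx // mxE; apply: derivableP; move/derivable_mxP: dA.
have dA1 : derivable A x v by apply/derivable_mxP => i j; have [] := dA i j.
split=> //; rewrite derive_mx //; apply/matrixP => i j; rewrite mxE.
exact: derive_val.
Qed.

Lemma is_derive_mulmx m n p (A : V -> 'M[R]_(m, n)) (B : V -> 'M[R]_(n, p))
    A' B' x v :
  is_derive x v A A' -> is_derive x v B B' ->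
  is_derive x v (fun y => A y *m B y) (A' *m B x + A x *m B').
Proof.
move=> /is_derive_mxP dA /is_derive_mxP dB; apply/is_derive_mxP => i j.
under eq_fun do rewrite mxE.
have := @is_derive_sum _ _ _ n (fun k y => A y i k * B y k j) x v
  (fun k => A x i k * B' k j + B x k j * A' i k)
  (fun k => is_deriveM (dA i k) (dB k j)).
rewrite fct_sumE => H; apply: (is_derive_eq H).
rewrite !mxE -big_split /=; apply: eq_bigr => k _.
by rewrite addrC [B x k j * _]mulrC.
Qed.

Lemma is_derive_trmx m n (A : V -> 'M[R]_(m, n)) A' x v :
  is_derive x v A A' -> is_derive x v (fun y => (A y)^T) A'^T.
Proof.
move=> /is_derive_mxP dA; apply/is_derive_mxP => i j.
by under eq_fun do rewrite mxE; rewrite mxE.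
Qed.

(** Lets one differentiate an identity that only holds near the point. *)
Lemma is_derive_near_unique (W : normedModType R) (f h : V -> W) f' h' x v :
  (\forall y \near x, f y = h y) ->
  is_derive x v f f' -> is_derive x v h h' -> f' = h'.
Proof. by move=> fh [_ <-] [_ <-]; apply: near_eq_derive. Qed.

End MatrixCalculus.

Section SmoothFunctions.
Variables (R : realType) (n : nat) (U : set 'cV[R]_n).
Hypothesis oU : open U.
Implicit Types (f : 'cV[R]_n -> R) (x : 'cV[R]_n).

Lemma smooth_on_derivable f x j : smooth_on U f -> U x ->
  derivable f x (basis_vec R j).
Proof. by move=> /(_ 1)[_ /(_ j)[+ _]]; apply. Qed.

Lemma smooth_on_partial f j : smooth_on U f -> smooth_on U (partial j f).
Proof. by move=> sf k; have [_ /(_ j)[]] := sf k.+1. Qed.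

Lemma smooth_on_continuous f x : smooth_on U f -> U x ->
  {for x, continuous f}.
Proof.
move=> /(_ 0)[+ _] Ux; rewrite continuous_open_subspace // => cf.
by apply: cf; rewrite inE.
Qed.

Lemma partial_comm f i j x : smooth_on U f -> U x ->
  partial i (partial j f) x = partial j (partial i f) x.
Proof.
move=> sf Ux; apply: (@derive_comm _ _ f _ _ x U) => //.
- by move=> y; apply: smooth_on_derivable.
- by move=> y; apply: smooth_on_derivable.
- by move=> y; exact: (smooth_on_derivable (smooth_on_partial j sf)).
- by move=> y; exact: (smooth_on_derivable (smooth_on_partial i sf)).
- exact: (smooth_on_continuous (smooth_on_partial i (smooth_on_partial j sf))).
- exact: (smooth_on_continuous (smooth_on_partial j (smooth_on_partial i sf))).
Qed.

End SmoothFunctions.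

(** * Connection forms, the Riemann symmetries and the Hermitian connection *)

Section MatrixLinear.
Variables (K : pzRingType) (m n : nat).
Implicit Types (A B : 'M[K]_(m, n)).

Lemma addmxE A B a b : (A + B) a b = A a b + B a b.
Proof. by rewrite mxE. Qed.

Lemma oppmxE A a b : (- A) a b = - A a b.
Proof. by rewrite mxE. Qed.

Lemma scalemxE (k : K) A a b : (k *: A) a b = k * A a b.
Proof. by rewrite mxE. Qed.

End MatrixLinear.

Definition mxlinE := (addmxE, oppmxE, scalemxE).

(** Comparing entries turns the products of matrices into atoms for linear
arithmetic, which then decides identities in a noncommutative ring. *)
Ltac mx_lra := apply/matrixP => ? ?; rewrite !mxlinE; lra.

(** The algebraic symmetries of a Riemann tensor, in an arbitrary ring because
they are used for real coordinate components and for components in a complex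
frame. *)
Definition riemann_symmetric (K : pzRingType) (n : nat)
    (T : 'I_n -> 'I_n -> 'I_n -> 'I_n -> K) : Prop :=
  [/\ forall i j k l, T j i k l = - T i j k l,
      forall i j k l, T i j l k = - T i j k l,
      forall i j k l, T k l i j = T i j k l &
      forall i j k l, T i j k l + T j k i l + T k i j l = 0].

(** For n = 4 these are the endomorphisms that correspond, via [g], to the
real forms of type (2,0) + (0,2), a bundle of real rank 2 inside the self-dual
forms. *)
Definition skew_anticommuting (K : pzRingType) (n : nat) (g J A : 'M[K]_n) : Prop :=
  A *m J = - (J *m A) /\ A^T *m g = - (g *m A).

Section Curvature.
Variables (R : realType) (n : nat) (U : set 'cV[R]_n).
Hypothesis oU : open U.
Notation e i := (basis_vec R i : 'cV[R]_n).
Notation field := ('cV[R]_n -> 'cV[R]_n).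

Lemma near_open (P : 'cV[R]_n -> Prop) x : U x ->
  (forall y, U y -> P y) -> \forall y \near x, P y.
Proof.
move=> Ux UP; have : nbhs x U by apply: open_nbhs_nbhs.
by apply: filterS.
Qed.

Lemma smooth_mx_is_derive (A : 'cV[R]_n -> 'M[R]_n) x j :
  smooth_mx_on U A -> U x -> is_derive x (e j) A ('D_(e j) A x).
Proof.
move=> sA Ux; apply: derivableP; apply/derivable_mxP => a b.
exact: (smooth_on_derivable (sA a b)).
Qed.

Lemma smooth_mx_deriveE (A : 'cV[R]_n -> 'M[R]_n) x j a b :
  smooth_mx_on U A -> U x ->
  ('D_(e j) A x) a b = partial j (fun y => A y a b) x.
Proof.
move=> sA Ux; rewrite derive_mx ?mxE //.
by have [] := smooth_mx_is_derive j sA Ux.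
Qed.

Lemma smooth_mx_derive2 (A : 'cV[R]_n -> 'M[R]_n) x i j :
  smooth_mx_on U A -> U x ->
  is_derive x (e i) ('D_(e j) A)
   (\matrix_(a, b) partial i (partial j (fun y => A y a b)) x).
Proof.
move=> sA Ux; apply/is_derive_mxP => a b; rewrite mxE.
apply: (@near_eq_is_derive _ _ _ (partial j (fun y => A y a b))).
  by apply: near_open Ux _ => y Uy; rewrite smooth_mx_deriveE.
apply: derivableP; exact: (smooth_on_derivable (smooth_on_partial j (sA a b))).
Qed.

(** [G i] is the matrix of the connection form of [nabla] along the i-th
coordinate field. Derivability of [Y] matters because 'D is a default value
otherwise. *)
Definition connection_form_on (nabla : field -> field -> field)
    (G : 'I_n -> 'cV[R]_n -> 'M[R]_n) :=
  forall i (Y : field) y, U y -> derivable Y y (e i) ->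
  nabla (fun=> e i) Y y = 'D_(e i) Y y + G i y *m Y y.

Definition curvature_form (G : 'I_n -> 'cV[R]_n -> 'M[R]_n) x i j : 'M[R]_n :=
  'D_(e i) (G j) x - 'D_(e j) (G i) x + G i x *m G j x - G j x *m G i x.

Lemma lie_bracket_const (u v : 'cV[R]_n) :
  lie_bracket (fun=> u) (fun=> v) = fun=> 0.
Proof.
apply/funext => x; apply/matrixP => a b; rewrite !mxE.
by rewrite !big1 ?subrr // => i _; rewrite /partial derive_cst mulr0.
Qed.

(** The usual formula d G + G /\ G. Covariant derivatives of a coordinate
field are only known on [U], so the outer derivative is taken through an
identity valid near [x]. *)
Lemma curvature_coord nabla G x i j k :
  connection_form_on nabla G -> (forall Y, nabla (fun=> 0) Y x = 0) -> U x ->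
  (forall i j, derivable (G j) x (e i)) ->
  curvature nabla (fun=> e i) (fun=> e j) (fun=> e k) x
  = curvature_form G x i j *m e k.
Proof.
move=> nablaG nabla0 Ux dG.
have first_order l y : U y -> nabla (fun=> e l) (fun=> e k) y = G l y *m e k.
  move=> Uy; rewrite (nablaG l _ y Uy (derivable_cst _ _ _)).
  by rewrite (derive_cst (e k)) add0r.
have second_order a b : nabla (fun=> e a) (nabla (fun=> e b) (fun=> e k)) x
    = ('D_(e a) (G b) x + G a x *m G b x) *m e k.
  have D : is_derive x (e a) (nabla (fun=> e b) (fun=> e k))
      ('D_(e a) (G b) x *m e k).
    apply: (@near_eq_is_derive _ _ _ (fun y => G b y *m e k)).
      by apply: near_open Ux _ => y Uy; rewrite first_order.
    have := is_derive_mulmx (derivableP (dG a b)) (is_derive_cst (e k) x (e a)).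
    by rewrite mulmx0 addr0.
  rewrite nablaG //.
  by rewrite derive_val first_order // mulmxDl mulmxA.
rewrite /curvature lie_bracket_const nabla0 subr0 !second_order -mulmxBl.
congr (_ *m _); rewrite /curvature_form; mx_lra.
Qed.

Variables g J : 'cV[R]_n -> 'M[R]_n.

Definition levi_civita_form j x : 'M[R]_n := \matrix_(k, i) christoffel g k j i x.

Notation Gam := levi_civita_form.

Definition covariant_acs j x : 'M[R]_n :=
  'D_(e j) J x + Gam j x *m J x - J x *m Gam j x.

(** The difference A = -1/2 J (D J) between the Hermitian and the Levi-Civita
connection. *)
Definition contorsion j x : 'M[R]_n := - (2^-1 *: (J x *m covariant_acs j x)).

Definition hermitian_connection_form j x : 'M[R]_n := Gam j x + contorsion j x.

Lemma deriv_along_coord i (Y : field) y : derivable Y y (e i) ->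
  deriv_along (fun=> e i) Y y = 'D_(e i) Y y.
Proof.
move=> dY; apply/matrixP => a b; rewrite mxE derive_mx // mxE ord1.
rewrite (bigD1 i) //= big1 => [|k ki]; rewrite mxE ?eqxx ?mul1r ?addr0 //.
by rewrite (negbTE ki) mul0r.
Qed.

Lemma levi_civita_coord : connection_form_on (levi_civita g) Gam.
Proof.
move=> i Y y Uy dY; rewrite /levi_civita deriv_along_coord //.
congr (_ + _); apply/matrixP => k b; rewrite !mxE ord1.
rewrite (bigD1 i) //= [X in _ + X]big1 ?addr0 => [|l li].
  by apply: eq_bigr => l _; rewrite !mxE !eqxx mulr1.
by apply: big1 => m _; rewrite !mxE (negbTE li) mulr0 mul0r.
Qed.

Lemma levi_civita0 Y x : levi_civita g (fun=> 0) Y x = 0.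
Proof.
apply/matrixP => a b; rewrite !mxE !big1 ?addr0 // => i _.
  by apply: big1 => j _; rewrite mxE mulr0 mul0r.
by rewrite mxE mul0r.
Qed.

Lemma hermitian_connection0 Y x : hermitian_connection g J (fun=> 0) Y x = 0.
Proof.
by rewrite /hermitian_connection /levi_civita_acs !levi_civita0 mulmx0 subr0
  mulmx0 scaler0 subr0.
Qed.

Hypothesis gsm : smooth_mx_on U g.
Hypothesis Jsm : smooth_mx_on U J.

(** The derivative of [J] produced by the Leibniz rule in D (J Y) is what
turns the connection form into [Gam + A]. *)
Lemma hermitian_coord :
  connection_form_on (hermitian_connection g J) hermitian_connection_form.
Proof.
move=> i Y y Uy dY; rewrite /hermitian_connection /levi_civita_acs.
have dJY := is_derive_mulmx (smooth_mx_is_derive i Jsm Uy) (derivableP dY).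
have dJY' : derivable (fun y => J y *m Y y) y (e i) by have [] := dJY.
rewrite (levi_civita_coord Uy dY) (levi_civita_coord Uy dJY').
rewrite (@derive_val _ _ _ _ _ _ _ dJY) /hermitian_connection_form /contorsion /covariant_acs.
rewrite !(mulmxDl, mulmxDr, mulmxN, mulNmx, mulmxA) -!scalemxAl.
rewrite !(mulmxDl, mulmxN, mulNmx, mulmxA); mx_lra.
Qed.

Hypothesis gsym : forall y, U y -> (g y)^T = g y.
Hypothesis gunit : forall y, U y -> g y \in unitmx.

Lemma gsymE y a b : U y -> g y a b = g y b a.
Proof. by move=> Uy; rewrite -{1}(gsym Uy) mxE. Qed.

Lemma partial_gsym j y a b : U y ->
  partial j (fun y => g y a b) y = partial j (fun y => g y b a) y.
Proof.
move=> Uy; apply: near_eq_derive.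
by apply: near_open Uy _ => z Uz; rewrite gsymE.
Qed.

Lemma partial2_gsym i j y a b : U y ->
  partial i (partial j (fun y => g y a b)) y
  = partial i (partial j (fun y => g y b a)) y.
Proof.
move=> Uy; apply: near_eq_derive.
by apply: near_open Uy _ => z Uz; apply: partial_gsym.
Qed.

Lemma levi_civita_form_derivable i j x : U x -> derivable (Gam j) x (e i).
Proof.
move=> Ux; apply/derivable_mxP => a b; under eq_fun do rewrite mxE.
rewrite /christoffel; apply: derivableM; first exact: derivable_cst.
apply: derivable_bigsum => l; apply: derivableM.
  have /derivable_mxP : derivable (fun y => invmx (g y)) x (e i); last exact.
  apply: derivable_invmx; first by have [] := smooth_mx_is_derive i gsm Ux.
  exact: near_open Ux gunit.
have dg k c d : derivable (partial k (fun y => g y c d)) x (e i).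
  exact: (smooth_on_derivable (smooth_on_partial k (gsm c d))).
by apply: derivableB; first apply: derivableD.
Qed.

(** The Christoffel symbols of the first kind: lowering the index with [g]
removes the inverse matrix. *)
Lemma koszul x j l k : U x -> (g x *m Gam j x) l k =
  2^-1 * (partial j (fun y => g y k l) x + partial k (fun y => g y j l) x
          - partial l (fun y => g y j k) x).
Proof.
move=> Ux; rewrite !mxE.
pose b m := partial j (fun y => g y k m) x + partial k (fun y => g y j m) x
          - partial m (fun y => g y j k) x.
rewrite -[X in _ = _ * X]/(b l).
have -> : b l = (g x *m (invmx (g x) *m (\col_m b m))) l 0.
  by rewrite mulmxA mulmxV ?gunit // mul1mx mxE.
rewrite !mxE mulr_sumr; apply: eq_bigr => m _.
rewrite !mxE /christoffel mulrCA; congr (_ * (_ * _)).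
by apply: eq_bigr => p _; rewrite mxE.
Qed.

Lemma levi_civita_metric x j : U x ->
  'D_(e j) g x = g x *m Gam j x + (Gam j x)^T *m g x.
Proof.
move=> Ux; apply/matrixP => a b; rewrite (smooth_mx_deriveE _ _ _ gsm Ux) addmxE.
have -> : ((Gam j x)^T *m g x) a b = (g x *m Gam j x) b a.
  by rewrite -{1}(gsym Ux) -trmx_mul mxE.
rewrite !koszul // (partial_gsym j b a Ux); lra.
Qed.

Lemma levi_civita_torsion_free x i j k : U x -> Gam i x k j = Gam j x k i.
Proof.
move=> Ux; rewrite !mxE /christoffel; congr (_ * _); apply: eq_bigr => l _.
by rewrite (partial_gsym l i j Ux) [partial i _ _ + _]addrC.
Qed.

Lemma curvature_tensorE nabla G x i j k l :
  connection_form_on nabla G -> (forall Y, nabla (fun=> 0) Y x = 0) -> U x ->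
  (forall i j, derivable (G j) x (e i)) ->
  curvature_tensor nabla g x i j k l = (g x *m curvature_form G x i j) l k.
Proof.
move=> nablaG nabla0 Ux dG; rewrite /curvature_tensor (curvature_coord _ _ _ nablaG) //.
rewrite trmx_mul -!mulmxA [_^T *m (g x *m _)]mulmxA -{1}(gsym Ux) -trmx_mul.
rewrite (_ : (basis_vec R k)^T = delta_mx 0 k) ?trmx_delta // -rowE.
by rewrite -colE !mxE.
Qed.

(** Differentiating the lowered connection form rather than the Christoffel
symbols avoids the derivative of the inverse metric. *)
Lemma derive_lowered_form x i j : U x ->
  is_derive x (e i) (fun y => g y *m Gam j y)
    (\matrix_(l, k) (2^-1 * (partial i (partial j (fun y => g y k l)) x
                       + partial i (partial k (fun y => g y j l)) x
                       - partial i (partial l (fun y => g y j k)) x))).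
Proof.
move=> Ux; apply/is_derive_mxP => l k; rewrite mxE.
apply: (@near_eq_is_derive _ _ _ (fun y => 2^-1 *
   (partial j (fun y => g y k l) y + partial k (fun y => g y j l) y
          - partial l (fun y => g y j k) y))).
  by apply: near_open Ux _ => y Uy; rewrite koszul.
have dg m c d : is_derive x (e i) (partial m (fun y => g y c d))
    (partial i (partial m (fun y => g y c d)) x).
  apply: derivableP.
  exact: (smooth_on_derivable (smooth_on_partial m (gsm c d))).
exact: is_deriveZ.
Qed.

Let q x i l j k := ((Gam i x)^T *m g x *m Gam j x) l k.
Let d2g x i j k l := partial i (partial j (fun y => g y k l)) x.

(** The coordinate expression of the lowered Riemann tensor: second
derivatives of the metric and products of Christoffel symbols. The terms in
the second derivatives of [g k l] along e_i and e_j cancel because partial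
derivatives commute. *)
Lemma levi_civita_curvatureE x i j k l : U x ->
  curvature_tensor (levi_civita g) g x i j k l =
  2^-1 * (d2g x i k j l - d2g x i l j k - d2g x j k i l + d2g x j l i k)
  - q x i l j k + q x j l i k.
Proof.
move=> Ux; rewrite (curvature_tensorE _ _ _ _ levi_civita_coord) //; first last.
- by move=> a b; apply: levi_civita_form_derivable.
- by move=> Y; apply: levi_civita0.
have DE a b : (g x *m 'D_(e a) (Gam b) x) l k =
    2^-1 * (d2g x a b k l + d2g x a k b l - d2g x a l b k)
    - (g x *m Gam a x *m Gam b x) l k - q x a l b k.
  have [_ D] := derive_lowered_form a b Ux.
  have [_] := is_derive_mulmx (smooth_mx_is_derive a gsm Ux)
    (derivableP (@levi_civita_form_derivable a b x Ux)).
  rewrite {}D levi_civita_metric // mulmxDl => /matrixP /(_ l k).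
  rewrite mxE !addmxE.
  have isolate (s t u v : R) : s = t + u + v -> v = s - t - u by lra.
  exact: isolate.
have expand (D1 D2 G1 G2 : 'M[R]_n) :
    (g x *m (D1 - D2 + G1 *m G2 - G2 *m G1)) l k =
    (g x *m D1) l k - (g x *m D2) l k
    + (g x *m G1 *m G2) l k - (g x *m G2 *m G1) l k.
  by rewrite mulmxBr mulmxDr mulmxBr !mulmxA !mxlinE.
have combine (D Q : 'I_n -> 'I_n -> 'I_n -> 'I_n -> R) v1 v2 X1 X2 :
    D j i k l = D i j k l ->
    v1 = 2^-1 * (D i j k l + D i k j l - D i l j k) - X1 - Q i l j k ->
    v2 = 2^-1 * (D j i k l + D j k i l - D j l i k) - X2 - Q j l i k ->
    v1 - v2 + X1 - X2 =
    2^-1 * (D i k j l - D i l j k - D j k i l + D j l i k) - Q i l j k + Q j l i k.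
  by move=> sC -> ->; lra.
rewrite /curvature_form expand.
exact: (combine _ (q x) _ _ _ _ (partial_comm oU j i (gsm k l) Ux) (DE i j) (DE j i)).
Qed.

(** All four symmetries can be read off from [levi_civita_curvatureE] and the
symmetries of the second derivatives of [g]. *)
Lemma levi_civita_riemann_symmetric x : U x ->
  riemann_symmetric (curvature_tensor (levi_civita g) g x).
Proof.
move=> Ux.
have qC i l j k : q x j k i l = q x i l j k.
  have E : (Gam i x)^T *m g x *m Gam j x = ((Gam j x)^T *m g x *m Gam i x)^T.
    by rewrite !trmx_mul trmxK gsym // mulmxA.
  by rewrite /q E [RHS]mxE.
have qT i l j k : q x i l j k = q x l i j k.
  rewrite /q -!mulmxA !mxE; apply: eq_bigr => m _; rewrite ![_^T _ _]mxE.
  by rewrite (levi_civita_torsion_free i l m Ux).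
have s2 i j a b : d2g x i j a b = d2g x i j b a := partial2_gsym i j a b Ux.
have sC i j a b : d2g x i j a b = d2g x j i a b := partial_comm oU i j (gsm a b) Ux.
have RE i j k l := levi_civita_curvatureE i j k l Ux.
move: (curvature_tensor _ _ _) (d2g x) (q x) qC qT s2 sC RE => T D Q qC qT s2 sC RE.
have qT' i l j k : Q i l j k = Q i l k j by rewrite qC qT -qC.
split=> i j k l; rewrite !RE.
- lra.
- have E1 := qC i k j l; have E2 := qC i l j k; lra.
- rewrite (qT k j) (qT l j) (qT' j k) (qT' j l k) (qC i l).
  rewrite (sC k i) (sC k j) (sC l i) (sC l j) (s2 _ _ l j) (s2 _ _ l i).
  rewrite (s2 _ _ k j) (s2 _ _ k i); lra.
- rewrite (qT' j l k) (qT' k l j) (qT' i l k) (sC j i) (sC k j) (sC k i).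
  rewrite (s2 _ _ k j) (s2 _ _ k i) (s2 _ _ j i); lra.
Qed.

Hypothesis Jsqr : forall y, U y -> J y *m J y = - 1%:M.
Hypothesis Jorth : forall y, U y -> (J y)^T *m g y *m J y = g y.

Notation N := covariant_acs.
Notation A := contorsion.

Lemma acs_skew y : U y -> (J y)^T *m g y = - (g y *m J y).
Proof.
move=> Uy; rewrite -{2}(Jorth Uy) -[_ *m J y *m J y]mulmxA Jsqr //.
by rewrite mulmxN mulmx1 opprK.
Qed.

(** Differentiate J^2 = -1 and the skewness of [g J], and use that the
Levi-Civita connection is metric. *)
Lemma covariant_acs_skew j y : U y -> skew_anticommuting (g y) (J y) (N j y).
Proof.
move=> Uy; have dJ := smooth_mx_is_derive j Jsm Uy.
have dg := smooth_mx_is_derive j gsm Uy.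
have E1 := is_derive_near_unique (near_open Uy Jsqr)
  (is_derive_mulmx dJ dJ) (is_derive_cst _ _ _).
have E2 := is_derive_near_unique (near_open Uy acs_skew)
  (is_derive_mulmx (is_derive_trmx dJ) dg) (is_deriveN (is_derive_mulmx dg dJ)).
move: E1 E2; rewrite levi_civita_metric // /covariant_acs.
move: ('D_(e j) J y) (Gam j y) => D G E1 E2; split.
  move/eqP: E1; rewrite addr_eq0 => /eqP E1.
  rewrite !(mulmxBl, mulmxBr, mulmxDl, mulmxDr) E1 -!mulmxA Jsqr // !mulmxN mulmx1.
  rewrite !mulmxA Jsqr // !mulNmx mul1mx; mx_lra.
have a1 : (J y)^T *m g y *m G = - (g y *m J y *m G) by rewrite acs_skew // mulNmx.
have a2 : G^T *m (J y)^T *m g y = - (G^T *m g y *m J y).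
  by rewrite -mulmxA acs_skew // mulmxN mulmxA.
have -> : (D + G *m J y - J y *m G)^T = D^T + (J y)^T *m G^T - G^T *m (J y)^T.
  by rewrite linearB linearD /= !trmx_mul.
move: E2; rewrite !(mulmxBl, mulmxBr, mulmxDl, mulmxDr) !mulmxA a1 a2 => /matrixP E2.
by apply/matrixP => a b; move: (E2 a b); rewrite !mxlinE; lra.
Qed.

Lemma contorsion_skew j y : U y -> skew_anticommuting (g y) (J y) (A j y).
Proof.
move=> Uy; have [] := covariant_acs_skew j Uy; rewrite /contorsion.
move: (N j y) => B BJ Bg; split.
  rewrite mulNmx mulmxN -scalemxAl -scalemxAr -mulmxA BJ.
  by rewrite !mulmxN scalerN !opprK.
rewrite linearN linearZ /= trmx_mul mulNmx mulmxN -scalemxAl -scalemxAr.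
rewrite -mulmxA acs_skew // mulmxN mulmxA Bg mulNmx opprK.
by rewrite -mulmxA BJ mulmxN mulmxA scalerN opprK.
Qed.

Lemma contorsion_derivable i j x : U x -> derivable (A j) x (e i).
Proof.
move=> Ux; have dJ := smooth_mx_is_derive i Jsm Ux.
have dG := derivableP (@levi_civita_form_derivable i j x Ux).
have d2J := smooth_mx_derive2 i j Jsm Ux.
have dN := is_deriveB (is_deriveD d2J (is_derive_mulmx dG dJ))
  (is_derive_mulmx dJ dG).
by have [] := is_deriveN (is_deriveZ 2^-1 (is_derive_mulmx dJ dN)).
Qed.

(** The covariant derivative D_i (A_j) for the coordinate index j held fixed;
its skew part in i, j is the exterior covariant derivative of [A]. *)
Definition covariant_contorsion i j x : 'M[R]_n :=
  'D_(e i) (A j) x + Gam i x *m A j x - A j x *m Gam i x.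

(** The covariant derivative of the identity A J + J A = 0. It determines the
part of D_i A_j that commutes with [J] by first derivatives of [J] alone, so
that the second derivatives of [J] never enter. *)
Lemma covariant_contorsion_acs i j x : U x ->
  covariant_contorsion i j x *m J x + J x *m covariant_contorsion i j x =
  - (A j x *m N i x + N i x *m A j x).
Proof.
move=> Ux; have dJ := smooth_mx_is_derive i Jsm Ux.
have dA := derivableP (@contorsion_derivable i j x Ux).
have AJ y : U y -> A j y *m J y = - (J y *m A j y).
  by move=> Uy; have [] := contorsion_skew j Uy.
have E := is_derive_near_unique (near_open Ux AJ)
  (is_derive_mulmx dA dJ) (is_deriveN (is_derive_mulmx dJ dA)).
move: E (AJ x Ux); rewrite /covariant_contorsion /covariant_acs.
move: ('D_(e i) J x) ('D_(e i) (A j) x) (Gam i x) (A j x) => DJ DA G B E BJ.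
have b1 : G *m B *m J x = - (G *m J x *m B) by rewrite -!mulmxA BJ mulmxN.
have b2 : B *m J x *m G = - (J x *m B *m G) by rewrite BJ mulNmx.
move: E; rewrite !(mulmxBl, mulmxBr, mulmxDl, mulmxDr) !mulmxA b1 b2 => /matrixP E.
by apply/matrixP => a b; move: (E a b); rewrite !mxlinE; lra.
Qed.

(** The curvature of D + A is R + d^D A + [A, A]. *)
Lemma hermitian_curvatureE x i j k l : U x ->
  curvature_tensor (hermitian_connection g J) g x i j k l =
  curvature_tensor (levi_civita g) g x i j k l +
  (g x *m (covariant_contorsion i j x - covariant_contorsion j i x
           + A i x *m A j x - A j x *m A i x)) l k.
Proof.
move=> Ux.
have dG a b := @levi_civita_form_derivable a b x Ux.
have dA a b := @contorsion_derivable a b x Ux.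
have dH a b : derivable (hermitian_connection_form b) x (e a).
  exact: (derivableD (dG a b) (dA a b)).
rewrite (curvature_tensorE i j k l hermitian_coord (hermitian_connection0^~ x) Ux dH).
rewrite (curvature_tensorE i j k l levi_civita_coord (levi_civita0^~ x) Ux dG).
rewrite -addmxE -mulmxDr; congr ((_ *m _) _ _).
have DH a b : 'D_(e a) (hermitian_connection_form b) x = 'D_(e a) (Gam b) x + 'D_(e a) (A b) x.
  exact: (deriveD (dG a b) (dA a b)).
have CE (G : 'I_n -> 'cV[R]_n -> 'M[R]_n) D1 D2 : 'D_(e i) (G j) x = D1 ->
    'D_(e j) (G i) x = D2 ->
    curvature_form G x i j = D1 - D2 + G i x *m G j x - G j x *m G i x.
  by move=> <- <-.
rewrite (CE _ _ _ (DH i j) (DH j i)) (CE Gam _ _ erefl erefl).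
have regroup (D1 D2 D3 D4 G1 G2 A1 A2 : 'M[R]_n) :
  (D1 + D3) - (D2 + D4) + (G1 + A1) *m (G2 + A2) - (G2 + A2) *m (G1 + A1) =
  (D1 - D2 + G1 *m G2 - G2 *m G1) +
  ((D3 + G1 *m A2 - A2 *m G1) - (D4 + G2 *m A1 - A1 *m G2) + A1 *m A2 - A2 *m A1).
  rewrite !mulmxDl !mulmxDr; mx_lra.
exact: regroup.
Qed.

End Curvature.

(** * The Hodge star and adapted complex frames *)

Lemma congruence_mxE (K : comPzRingType) n (B F : 'M[K]_n) k l :
  (F^T *m B *m F) k l = \sum_i \sum_j B i j * (F i k * F j l).
Proof.
rewrite mxE exchange_big; apply: eq_bigr => j _.
rewrite mxE mulr_suml; apply: eq_bigr => i _.
by rewrite mxE [F i k * _]mulrC mulrA.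
Qed.

Lemma congruence_skew (K : comPzRingType) n (B F : 'M[K]_n) :
  B^T = - B -> (F^T *m B *m F)^T = - (F^T *m B *m F).
Proof. by move=> BT; rewrite !trmx_mul trmxK BT mulNmx mulmxN mulmxA. Qed.

Section HodgeStar.
Variables (K : fieldType) (g J : 'M[K]_4).
Hypothesis two_neq0 : (2 : K) != 0.
Hypothesis gsym : g^T = g.
Hypothesis gunit : g \in unitmx.
Hypothesis Jskew : J^T *m g = - (g *m J).

Lemma volume_formE i j k l : let F := fundamental_form g J in
  volume_form g J i j k l = F i j * F k l - F i k * F j l + F i l * F j k.
Proof. by move=> F; rewrite /volume_form /wedge22 -/F; field. Qed.

(** Expanding F /\ F gives three terms. The first pairs the form with [F], the
other two both give [J^T b J] because [J] is orthogonal. Hence * is +1 on F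
and on the J-anti-invariant forms, and -1 on the primitive J-invariant ones.
*)
Lemma hodge_skewE b : b^T = - b ->
  hodge g J b = (2^-1 * \tr (invmx g *m b *m J)) *: fundamental_form g J
                - J^T *m b *m J.
Proof.
move=> bT; set F := fundamental_form g J.
pose bup := invmx g *m b *m (invmx g)^T.
have giT : (invmx g)^T = invmx g by rewrite trmx_inv gsym.
have FT : F^T = g *m J by rewrite /F /fundamental_form trmx_mul trmxK gsym.
have bupT : bup^T = - bup.
  by rewrite /bup giT !trmx_mul giT bT mulNmx mulmxN mulmxA.
have trE : \tr (invmx g *m b *m J) = \sum_i \sum_j bup i j * F i j.
  have -> : invmx g *m b *m J = bup *m F^T.
    by rewrite FT /bup giT -!mulmxA (mulmxA (invmx g) g) mulVmx // mul1mx.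
  apply: eq_bigr => i _; rewrite mxE; apply: eq_bigr => j _.
  by rewrite [F^T _ _]mxE.
have conjE : F^T *m bup *m F = J^T *m b *m J.
  have FE : F = - (g *m J) by [].
  have -> : F^T = - (J^T *m g) by rewrite FT Jskew opprK.
  rewrite FE mulNmx mulNmx mulmxN opprK /bup giT -!mulmxA.
  rewrite (mulmxA (invmx g) g) mulVmx // mul1mx.
  by rewrite (mulmxA g (invmx g)) mulmxV // mul1mx.
have FbF := congruence_skew F bupT.
apply/matrixP => k l; rewrite [LHS]mxE addmxE oppmxE scalemxE -/bup.
under eq_bigr do under eq_bigr do rewrite volume_formE -/F mulrDr mulrBr mulrA.
under eq_bigr do rewrite big_split sumrB /= -mulr_suml.
rewrite big_split sumrB /= -mulr_suml -trE -congruence_mxE conjE.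
have -> : \sum_i \sum_j bup i j * (F i l * F j k) = - (J^T *m b *m J) k l.
  by rewrite -congruence_mxE -oppmxE -conjE -FbF [RHS]mxE.
by field.
Qed.

End HodgeStar.

Section HodgeLinear.
Variables (K : fieldType) (g J : 'M[K]_4).

Lemma hodge_is_linear : linear (hodge g J).
Proof.
move=> c a b; apply/matrixP => k l; rewrite /hodge.
rewrite !mxE /=.
rewrite [c * _]mulrCA -mulrDr; congr (_ * _); rewrite mulr_sumr -big_split.
apply: eq_bigr => i _; rewrite mulr_sumr -big_split; apply: eq_bigr => j _ /=.
rewrite mulmxDr mulmxDl -scalemxAr -scalemxAl addmxE scalemxE mulrDl.
by rewrite -mulrA.
Qed.

HB.instance Definition _ := GRing.isLinear.Build K 'M[K]_4 'M[K]_4 _ (hodge g J)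
  hodge_is_linear.

End HodgeLinear.

Lemma map_hodge (K L : fieldType) (f : {rmorphism K -> L}) (g J b : 'M[K]_4) :
  hodge (map_mx f g) (map_mx f J) (map_mx f b) = map_mx f (hodge g J b).
Proof.
apply/matrixP => k l; rewrite [LHS]mxE [RHS]mxE mxE rmorphM fmorphV rmorph_nat.
congr (_ * _); rewrite rmorph_sum; apply: eq_bigr => i _.
rewrite rmorph_sum; apply: eq_bigr => j _.
rewrite rmorphM /volume_form /wedge22 /fundamental_form -map_invmx !map_trmx -!map_mxM.
congr (_ * _); first by rewrite mxE.
move: (J^T *m g) => F; have FE a c : (map_mx f F) a c = f (F a c) by rewrite mxE.
by rewrite !FE !(rmorphD, rmorphN, rmorphM) /= fmorphV rmorph_nat.
Qed.

Definition o0 : 'I_4 := @Ordinal 4 0 isT.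
Definition o1 : 'I_4 := @Ordinal 4 1 isT.
Definition o2 : 'I_4 := @Ordinal 4 2 isT.
Definition o3 : 'I_4 := @Ordinal 4 3 isT.

Lemma ord4_ind (P : 'I_4 -> Prop) : P o0 -> P o1 -> P o2 -> P o3 -> forall a, P a.
Proof.
move=> P0 P1 P2 P3 [[|[|[|[|//]]]] ai].
- by rewrite (_ : Ordinal ai = o0) //; apply: val_inj.
- by rewrite (_ : Ordinal ai = o1) //; apply: val_inj.
- by rewrite (_ : Ordinal ai = o2) //; apply: val_inj.
- by rewrite (_ : Ordinal ai = o3) //; apply: val_inj.
Qed.

Lemma sum4 (V : nmodType) (F : 'I_4 -> V) :
  \sum_a F a = F o0 + F o1 + F o2 + F o3.
Proof.
rewrite !big_ord_recr big_ord0 /= add0r.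
by congr (_ + _ + _ + _); congr F; apply: val_inj.
Qed.

Section Frame.
Variables (R : realType).
Notation C := R[i].

(** The position of the conjugate vector, for frames ordered as z_1, z_2, conj
z_1, conj z_2. *)
Definition bar (a : 'I_4) : 'I_4 :=
  match val a with 0 => o2 | 1 => o3 | 2 => o0 | _ => o1 end.

Definition eps (a : 'I_4) : C := if (val a < 2)%N then 'i%C else - 'i%C.

Lemma barK : involutive bar.
Proof. by elim/ord4_ind. Qed.

Definition bil (M : 'M[C]_4) (X Y : 'cV[C]_4) : C := (X^T *m M *m Y) 0 0.

Lemma bilE M X Y : bil M X Y = \sum_i \sum_j M i j * X i 0 * Y j 0.
Proof.
rewrite /bil mxE exchange_big; apply: eq_bigr => j _; rewrite mxE mulr_suml.
by apply: eq_bigr => i _; rewrite mxE [X i 0 * _]mulrC.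
Qed.

Lemma bil_tr M X Y : bil M^T X Y = bil M Y X.
Proof.
have E : X^T *m M^T *m Y = (Y^T *m M *m X)^T by rewrite !trmx_mul trmxK mulmxA.
by rewrite /bil E [LHS]mxE.
Qed.

Lemma bilM (M A : 'M[C]_4) X Y : bil (M *m A) X Y = bil M X (A *m Y).
Proof. by rewrite /bil !mulmxA. Qed.

Lemma bilMl (M A : 'M[C]_4) X Y : bil (A^T *m M) X Y = bil M (A *m X) Y.
Proof. by rewrite /bil trmx_mul !mulmxA. Qed.

(** The relations between the vectors z_1, z_2, conj z_1, conj z_2 when z_1,
z_2 is a unitary frame of T10 and g is extended complex bilinearly. *)
Definition adapted_frame (g J : 'M[C]_4) (E : 'I_4 -> 'cV[C]_4) : Prop :=
  (forall a b, bil g (E a) (E b) = (b == bar a)%:R) /\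
  (forall a, J *m E a = eps a *: E a).

Variables (g J : 'M[C]_4) (E : 'I_4 -> 'cV[C]_4).
Hypothesis fE : adapted_frame g J E.

(** The Gram matrix of the frame is an involution, so a left inverse of the
frame matrix is known explicitly, and it is also a right inverse. *)
Lemma frame_resolution : (\sum_a E a *m (E (bar a))^T) *m g = 1%:M.
Proof.
have [EE _] := fE.
pose B := \matrix_(i, a) E a i 0; pose B' := \matrix_(a, i) E (bar a) i 0.
have -> : \sum_a E a *m (E (bar a))^T = B *m B'.
  apply/matrixP => i j; rewrite summxE mxE; apply: eq_bigr => a _.
  by rewrite !mxE big_ord1 !mxE.
rewrite -mulmxA; apply: mulmx1C; apply/matrixP => a b; rewrite mxE [RHS]mxE.
have := EE (bar a) b; rewrite barK eq_sym => <-.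
rewrite /bil mxE; apply: eq_bigr => j _; rewrite !mxE; congr (_ * _).
by apply: eq_bigr => i _; rewrite !mxE.
Qed.

Lemma frame_unitmx : g \in unitmx.
Proof. by have [] := mulmx1_unit frame_resolution. Qed.

Lemma frame_invmx : invmx g = \sum_a E a *m (E (bar a))^T.
Proof.
by rewrite -[LHS]mul1mx -frame_resolution -mulmxA mulmxV ?frame_unitmx // mulmx1.
Qed.

Lemma frame_decomposition X : X = \sum_a bil g (E (bar a)) X *: E a.
Proof.
rewrite -[LHS]mul1mx -frame_resolution !mulmx_suml; apply: eq_bigr => a _.
have -> : E a *m (E (bar a))^T *m g *m X = E a *m ((E (bar a))^T *m g *m X).
  by rewrite !mulmxA.
by rewrite [in LHS](mx11_scalar (_ *m X)) mul_mx_scalar.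
Qed.

Lemma bil_insert (M A : 'M[C]_4) X Y :
  bil (M *m invmx g *m A) X Y = \sum_a bil M X (E a) * bil A (E (bar a)) Y.
Proof.
rewrite frame_invmx mulmx_sumr mulmx_suml /bil mulmx_sumr mulmx_suml summxE.
apply: eq_bigr => a _.
have -> : X^T *m (M *m (E a *m (E (bar a))^T) *m A) *m Y =
    (X^T *m M *m E a) *m ((E (bar a))^T *m A *m Y) by rewrite !mulmxA.
by rewrite mxE big_ord1.
Qed.

(** The contraction of a 2-form with [F], which [hodge_skewE] needs, in terms
of frame components. *)
Lemma trace_frame (M : 'M[C]_4) :
  \tr (invmx g *m M *m J) = \sum_a eps a * bil M (E (bar a)) (E a).
Proof.
have [_ JE] := fE.
rewrite -mulmxA mxtrace_mulC -mulmxA frame_invmx !mulmx_sumr raddf_sum /=.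
apply: eq_bigr => a _.
rewrite 2!mulmxA -[M *m J *m E a]mulmxA JE -scalemxAr -scalemxAl linearZ /=.
by congr (_ * _); rewrite mxtrace_mulC mulmxA /bil /mxtrace big_ord1.
Qed.

End Frame.

(** * Evaluation of tensors on complex vectors *)

Section TensorEvaluation.
Variables (R : realType).
Notation C := R[i].
Notation tensor := ('I_4 -> 'I_4 -> 'I_4 -> 'I_4 -> R).
Implicit Types (T : tensor) (X Y Z W : 'cV[C]_4) (P Q : 'M[R]_4).

Lemma cplx_tensorD T1 T2 X Y Z W :
  cplx_tensor (fun i j k l => T1 i j k l + T2 i j k l) X Y Z W =
  cplx_tensor T1 X Y Z W + cplx_tensor T2 X Y Z W.
Proof.
rewrite /cplx_tensor; do 4 (rewrite -big_split; apply: eq_bigr => ? _ /=).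
by rewrite rmorphD; ring.
Qed.

Lemma cplx_tensorN T X Y Z W :
  cplx_tensor (fun i j k l => - T i j k l) X Y Z W = - cplx_tensor T X Y Z W.
Proof.
rewrite /cplx_tensor; do 4 (rewrite -sumrN; apply: eq_bigr => ? _ /=).
by rewrite rmorphN !mulNr.
Qed.

Lemma cplx_tensor_prod_14_23 P Q X Y Z W :
  cplx_tensor (fun i j k l => P i l * Q j k) X Y Z W =
  bil (cplx_mx P) X W * bil (cplx_mx Q) Y Z.
Proof.
rewrite !bilE /cplx_tensor mulr_suml; apply: eq_bigr => i _.
rewrite mulr_sumr; apply: eq_bigr => j _; rewrite mulr_sumr; apply: eq_bigr => k _.
by rewrite mulr_suml; apply: eq_bigr => l _; rewrite !mxE rmorphM /=; ring.
Qed.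

Lemma cplx_tensor_prod_13_24 P Q X Y Z W :
  cplx_tensor (fun i j k l => P i k * Q j l) X Y Z W =
  bil (cplx_mx P) X Z * bil (cplx_mx Q) Y W.
Proof.
rewrite !bilE /cplx_tensor mulr_suml; apply: eq_bigr => i _.
rewrite mulr_sumr; apply: eq_bigr => j _; rewrite mulr_suml; apply: eq_bigr => k _.
by rewrite mulr_sumr; apply: eq_bigr => l _; rewrite !mxE rmorphM /=; ring.
Qed.

Lemma eq_cplx_tensor T1 T2 X Y Z W : (forall i j k l, T1 i j k l = T2 i j k l) ->
  cplx_tensor T1 X Y Z W = cplx_tensor T2 X Y Z W.
Proof. by move=> E; do 4 (apply: eq_bigr => ? _); rewrite E. Qed.

Lemma cplx_tensor_swap12 T X Y Z W :
  cplx_tensor (fun i j k l => T j i k l) X Y Z W = cplx_tensor T Y X Z W.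
Proof.
rewrite /cplx_tensor exchange_big; do 4 (apply: eq_bigr => ? _).
by rewrite -!mulrA; congr (_ * _); rewrite mulrCA.
Qed.

Lemma cplx_tensor_swap23 T X Y Z W :
  cplx_tensor (fun i j k l => T i k j l) X Y Z W = cplx_tensor T X Z Y W.
Proof.
rewrite /cplx_tensor; apply: eq_bigr => i _; rewrite exchange_big.
do 3 (apply: eq_bigr => ? _).
by rewrite -!mulrA; congr (_ * (_ * _)); rewrite mulrCA.
Qed.

Lemma cplx_tensor_swap34 T X Y Z W :
  cplx_tensor (fun i j k l => T i j l k) X Y Z W = cplx_tensor T X Y W Z.
Proof.
rewrite /cplx_tensor; do 2 (apply: eq_bigr => ? _); rewrite exchange_big.
by do 2 (apply: eq_bigr => ? _); rewrite mulrAC.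
Qed.

Lemma cplx_tensor_conj T X Y Z W :
  conjc (cplx_tensor T X Y Z W) =
  cplx_tensor T (conj_mx X) (conj_mx Y) (conj_mx Z) (conj_mx W).
Proof.
rewrite /cplx_tensor; do 4 (rewrite rmorph_sum; apply: eq_bigr => ? _).
by rewrite !rmorphM [X in X * _ * _ * _ * _]conjc_real !mxE.
Qed.

(** Freezes the last two arguments: the star acts on the first pair of slots,
hence on this 2-form. *)
Definition slice T Z W : 'M[C]_4 :=
  \sum_k \sum_l (Z k 0 * W l 0) *: cplx_mx (\matrix_(i, j) T i j k l).

Lemma cplx_tensor_slice T X Y Z W : cplx_tensor T X Y Z W = bil (slice T Z W) X Y.
Proof.
rewrite bilE /cplx_tensor; apply: eq_bigr => i _; apply: eq_bigr => j _.
rewrite summxE !mulr_suml; apply: eq_bigr => k _.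
rewrite summxE !mulr_suml; apply: eq_bigr => l _.
by rewrite !mxE; ring.
Qed.

Lemma bilD (M N : 'M[C]_4) X Y : bil (M + N) X Y = bil M X Y + bil N X Y.
Proof. by rewrite /bil mulmxDr mulmxDl mxE. Qed.

Lemma bilN (M : 'M[C]_4) X Y : bil (- M) X Y = - bil M X Y.
Proof. by rewrite /bil mulmxN mulNmx mxE. Qed.

Lemma bilZ (k : C) (M : 'M[C]_4) X Y : bil (k *: M) X Y = k * bil M X Y.
Proof. by rewrite /bil -scalemxAr -scalemxAl mxE. Qed.

Lemma bilDr (M : 'M[C]_4) X Y Y' : bil M X (Y + Y') = bil M X Y + bil M X Y'.
Proof. by rewrite /bil mulmxDr mxE. Qed.

Lemma bilZr (k : C) (M : 'M[C]_4) X Y : bil M X (k *: Y) = k * bil M X Y.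
Proof. by rewrite /bil -scalemxAr mxE. Qed.

Lemma bilDl (M : 'M[C]_4) X X' Y : bil M (X + X') Y = bil M X Y + bil M X' Y.
Proof. by rewrite /bil linearD /= !mulmxDl mxE. Qed.

Lemma bilZl (k : C) (M : 'M[C]_4) X Y : bil M (k *: X) Y = k * bil M X Y.
Proof. by rewrite /bil linearZ /= -!scalemxAl mxE. Qed.

Lemma bil_skew (M : 'M[C]_4) X Y : M^T = - M -> bil M Y X = - bil M X Y.
Proof. by move=> MT; rewrite -bilN -MT bil_tr. Qed.

Lemma cplx_tensor_Dl T X X' Y Z W :
  cplx_tensor T (X + X') Y Z W = cplx_tensor T X Y Z W + cplx_tensor T X' Y Z W.
Proof. by rewrite !cplx_tensor_slice bilDl. Qed.

Lemma cplx_tensor_Zl T k X Y Z W :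
  cplx_tensor T (k *: X) Y Z W = k * cplx_tensor T X Y Z W.
Proof. by rewrite !cplx_tensor_slice bilZl. Qed.

End TensorEvaluation.

(** * The anti-self-dual Weyl tensor in an adapted frame *)

Section HodgeFrame.
Variables (R : realType).
Notation C := R[i].
Variables (g J : 'M[C]_4) (E : 'I_4 -> 'cV[C]_4).
Hypothesis fE : adapted_frame g J E.
Hypothesis gsym : g^T = g.
Hypothesis Jskew : J^T *m g = - (g *m J).

Lemma epsE : (eps R o0 = 'i%C) * (eps R o1 = 'i%C) *
  (eps R o2 = - 'i%C) * (eps R o3 = - 'i%C).
Proof. by []. Qed.

Lemma sqr_iC : 'i%C * 'i%C = -1 :> C.
Proof. by rewrite -expr2 sqr_i. Qed.

Lemma bil_hodge b a c : b^T = - b ->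
  bil (hodge g J b) (E a) (E c) =
  - 'i%C * (bil b (E o0) (E o2) + bil b (E o1) (E o3)) * (eps R a * (c == bar a)%:R)
  - eps R a * eps R c * bil b (E a) (E c).
Proof.
move=> bT; have [EE JE] := fE; have gu := frame_unitmx fE.
have two0 : (2 : C) != 0 by rewrite pnatr_eq0.
rewrite (hodge_skewE two0 gsym gu Jskew bT) bilD bilN bilZ (trace_frame fE) sum4.
rewrite /fundamental_form bilMl bilM bilMl !JE !bilZl bilZr EE !epsE.
rewrite -[bar o0]/o2 -[bar o1]/o3 -[bar o2]/o0 -[bar o3]/o1.
rewrite (bil_skew (E o0) (E o2) bT) (bil_skew (E o1) (E o3) bT).
by field.
Qed.

Lemma hodge_skew b : b^T = - b -> (hodge g J b)^T = - hodge g J b.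
Proof.
move=> bT; have two0 : (2 : C) != 0 by rewrite pnatr_eq0.
rewrite (hodge_skewE two0 gsym (frame_unitmx fE) Jskew bT) linearB linearZ /=.
rewrite (congruence_skew J bT) /fundamental_form trmx_mul trmxK gsym.
by rewrite -[g *m J]opprK -Jskew scalerN opprK opprB addrC.
Qed.

(** Types (2,0) and (0,2) are J-anti-invariant, z_1 /\ conj z_2 and its
conjugate are primitive and J-invariant, and on the two diagonal components
subtracting the form from its trace along F amounts to exchanging them. *)
Lemma hodge_frame b : b^T = - b -> let B M a c := bil M (E a) (E c) in
  [/\ B (hodge g J b) o0 o3 = - B b o0 o3, B (hodge g J b) o1 o2 = - B b o1 o2,
      B (hodge g J b) o0 o2 = B b o1 o3 /\ B (hodge g J b) o1 o3 = B b o0 o2 &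
      B (hodge g J b) o0 o1 = B b o0 o1 /\ B (hodge g J b) o2 o3 = B b o2 o3].
Proof.
move=> bT B; rewrite /B; have i2 := sqr_iC; split; rewrite !bil_hodge // !epsE /=.
- by rewrite mulr0 mulr0 mulrN i2 opprK mul1r add0r.
- by rewrite mulr0 mulr0 mulrN i2 opprK mul1r add0r.
- split; rewrite !mulr1 mulrN i2 mulrAC mulNr i2; ring.
- by split; rewrite !mulr0 ?mulrNN i2 mulN1r opprK add0r.
Qed.

End HodgeFrame.

Section WeylComponents.
Variables (K : fieldType) (L : 'I_4 -> 'I_4 -> 'I_4 -> 'I_4 -> K).

(** The contraction of the first and last slots with the inverse metric, which
pairs each frame vector with its conjugate. *)
Definition frame_ricci b c : K := \sum_a L a b c (bar a).

Definition frame_schouten b c : K :=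
  2^-1 * (frame_ricci b c - (\sum_a frame_ricci a (bar a)) / 6%:R * (c == bar b)%:R).

Definition frame_weyl a b c d : K :=
  let P := frame_schouten in
  L a b c d - (P a d * (c == bar b)%:R + P b c * (d == bar a)%:R
               - P a c * (d == bar b)%:R - P b d * (c == bar a)%:R).

End WeylComponents.

Section WeylFrame.
Variables (R : realType).
Notation C := R[i].
Variables (g J : 'M[R]_4) (Rm : 'I_4 -> 'I_4 -> 'I_4 -> 'I_4 -> R).
Variable E : 'I_4 -> 'cV[C]_4.
Let gC := cplx_mx g.
Let JC := cplx_mx J.
Hypothesis gsym : g^T = g.
Hypothesis Jskew : J^T *m g = - (g *m J).
Hypothesis fE : adapted_frame gC JC E.
Hypothesis Rsym : riemann_symmetric Rm.

Lemma gCsym : gC^T = gC.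
Proof. by rewrite /gC /cplx_mx map_trmx gsym. Qed.

Lemma JCskew : JC^T *m gC = - (gC *m JC).
Proof. by rewrite /JC /gC /cplx_mx map_trmx -!map_mxM -map_mxN Jskew. Qed.

Definition frame_components (T : 'I_4 -> 'I_4 -> 'I_4 -> 'I_4 -> R) a b c d : C :=
  cplx_tensor T (E a) (E b) (E c) (E d).

Notation L := (frame_components Rm).

Lemma frame_components_riemann : riemann_symmetric L.
Proof.
have [R1 R2 R3 R4] := Rsym; split=> a b c d; rewrite /frame_components.
- by rewrite -cplx_tensor_swap12 -cplx_tensorN; apply: eq_cplx_tensor.
- by rewrite -cplx_tensor_swap34 -cplx_tensorN; apply: eq_cplx_tensor.
- rewrite -cplx_tensor_swap23 -cplx_tensor_swap12 -cplx_tensor_swap34.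
  by rewrite -cplx_tensor_swap23; apply: eq_cplx_tensor.
- have cycle (T : 'I_4 -> 'I_4 -> 'I_4 -> 'I_4 -> R) X Y Z W : cplx_tensor T Y Z X W =
      cplx_tensor (fun i j k l => T j k i l) X Y Z W.
    by rewrite -(cplx_tensor_swap23 T) -(cplx_tensor_swap12 (fun i j k l => T i k j l)).
  rewrite (cycle Rm (E a)) (cycle Rm (E b)) (cycle _ (E a)) -!cplx_tensorD.
  rewrite (eq_cplx_tensor (T2 := fun _ _ _ _ => - 0)) => [|i j k l]; last first.
    by rewrite R4 oppr0.
  rewrite cplx_tensorN /cplx_tensor !big1 ?oppr0 // => i _.
  by do 3 (rewrite big1 // => ? _); rewrite !mul0r.
Qed.

(** A tensor is multilinear and the frame spans. *)
Lemma frame_components_eq0 (T : 'I_4 -> 'I_4 -> 'I_4 -> 'I_4 -> R) :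
  (forall a b c d, frame_components T a b c d = 0) ->
  forall i j k l, T i j k l = 0.
Proof.
have vanish T' Y Z W : (forall a, cplx_tensor T' (E a) Y Z W = 0) ->
    forall X, cplx_tensor T' X Y Z W = 0.
  move=> H X; rewrite (frame_decomposition fE X) sum4.
  by rewrite !cplx_tensor_Dl !cplx_tensor_Zl !H !mulr0 !addr0.
move=> T0.
have H1 X b c d : cplx_tensor T X (E b) (E c) (E d) = 0 by apply: vanish => a; apply: T0.
have H2 X Y c d : cplx_tensor T X Y (E c) (E d) = 0.
  by rewrite -cplx_tensor_swap12; apply: vanish => a; rewrite cplx_tensor_swap12.
have H3 X Y Z d : cplx_tensor T X Y Z (E d) = 0.
  rewrite -cplx_tensor_swap23 -cplx_tensor_swap12; apply: vanish => a.
  by rewrite cplx_tensor_swap12 cplx_tensor_swap23.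
have H4 X Y Z W : cplx_tensor T X Y Z W = 0.
  rewrite -cplx_tensor_swap34 -cplx_tensor_swap23 -cplx_tensor_swap12.
  apply: vanish => a.
  by rewrite cplx_tensor_swap12 cplx_tensor_swap23 cplx_tensor_swap34.
move=> i j k l; apply: (@complexI R).
transitivity (cplx_tensor T (delta_mx i 0) (delta_mx j 0) (delta_mx k 0) (delta_mx l 0));
  last by rewrite H4.
rewrite /cplx_tensor.
have pick (F : 'I_4 -> C) (i0 : 'I_4) :
    (forall i', i' != i0 -> F i' = 0) -> \sum_i' F i' = F i0.
  by move=> F0; rewrite (bigD1 i0) //= big1 ?addr0.
rewrite (pick _ i) => [|i' ni]; last first.
  do 3 (rewrite big1 // => ? _); by rewrite !mxE (negbTE ni) mulr0 !mul0r.
rewrite (pick _ j) => [|j' nj]; last first.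
  do 2 (rewrite big1 // => ? _); by rewrite !mxE (negbTE nj) mulr0 !mul0r.
rewrite (pick _ k) => [|k' nk]; last first.
  rewrite big1 // => ? _; by rewrite !mxE (negbTE nk) mulr0 !mul0r.
rewrite (pick _ l) => [|l' nl]; last by rewrite !mxE (negbTE nl) mulr0.
by rewrite !mxE !eqxx !mulr1.
Qed.

Lemma slice_skew (T : 'I_4 -> 'I_4 -> 'I_4 -> 'I_4 -> R) Z W :
  (forall i j k l, T j i k l = - T i j k l) -> (slice T Z W)^T = - slice T Z W.
Proof.
move=> Tskew; rewrite /slice linear_sum -sumrN; apply: eq_bigr => k _.
rewrite linear_sum -sumrN; apply: eq_bigr => l _ /=.
rewrite linearZ /= -scalerN; congr (_ *: _); apply/matrixP => i j.
by rewrite !mxE Tskew rmorphN.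
Qed.

Lemma weyl_skew i j k l : weyl g Rm j i k l = - weyl g Rm i j k l.
Proof. by have [R1 _ _ _] := Rsym; rewrite /weyl R1; ring. Qed.

(** Complexification and the contraction with the last two slots commute with
the star. *)
Lemma slice_weyl_minus Z W : slice (weyl_minus g J Rm) Z W =
  2^-1 *: (slice (weyl g Rm) Z W - hodge gC JC (slice (weyl g Rm) Z W)).
Proof.
rewrite /slice linear_sum /= -sumrB scaler_sumr; apply: eq_bigr => k _.
rewrite linear_sum /= -sumrB scaler_sumr; apply: eq_bigr => l _.
rewrite linearZ /= -scalerBr [in RHS]scalerA [in RHS]mulrC -[in RHS]scalerA; congr (_ *: _).
have -> : \matrix_(i, j) weyl_minus g J Rm i j k l =
    2^-1 *: (\matrix_(i, j) weyl g Rm i j k l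
             - hodge g J (\matrix_(i, j) weyl g Rm i j k l)).
  by apply/matrixP => i j; rewrite scalemxE addmxE oppmxE [LHS]mxE [X in X - _]mxE.
by rewrite /gC /JC /cplx_mx map_hodge map_mxZ map_mxB fmorphV rmorph_nat.
Qed.

Lemma cplx_invmx k l : (invmx g k l)%:C = \sum_a E a k 0 * E (bar a) l 0.
Proof.
have -> : (invmx g k l)%:C = invmx gC k l by rewrite /gC /cplx_mx -map_invmx mxE.
rewrite (frame_invmx fE) summxE; apply: eq_bigr => a _.
by rewrite mxE big_ord1 mxE.
Qed.

Lemma bil_ricci b c :
  bil (cplx_mx (\matrix_(j, k) ricci g Rm j k)) (E b) (E c) = frame_ricci L b c.
Proof.
rewrite bilE /frame_ricci /frame_components /cplx_tensor.
transitivity (\sum_j \sum_k \sum_i \sum_l \sum_a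
   (Rm i j k l)%:C * E a i 0 * E b j 0 * E c k 0 * E (bar a) l 0).
  apply: eq_bigr => j _; apply: eq_bigr => k _; rewrite !mxE /ricci rmorph_sum.
  rewrite !mulr_suml; apply: eq_bigr => i _; rewrite rmorph_sum !mulr_suml.
  apply: eq_bigr => l _; rewrite rmorphM /= cplx_invmx !mulr_suml.
  by apply: eq_bigr => a _; ring.
have -> (F : 'I_4 -> 'I_4 -> 'I_4 -> 'I_4 -> 'I_4 -> C) :
    \sum_j \sum_k \sum_i \sum_l \sum_a F j k i l a =
    \sum_a \sum_i \sum_j \sum_k \sum_l F j k i l a.
  under eq_bigr do under eq_bigr do under eq_bigr do rewrite exchange_big.
  under eq_bigr do under eq_bigr do rewrite exchange_big.
  under eq_bigr do rewrite exchange_big.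
  rewrite exchange_big; apply: eq_bigr => a _.
  under eq_bigr do rewrite exchange_big.
  by rewrite exchange_big.
by [].
Qed.

Lemma cplx_scalar_curvature :
  (scalar_curvature g Rm)%:C = \sum_b frame_ricci L b (bar b).
Proof.
rewrite /scalar_curvature rmorph_sum.
under [RHS]eq_bigr do rewrite -bil_ricci bilE.
rewrite exchange_big; apply: eq_bigr => j _.
rewrite exchange_big rmorph_sum; apply: eq_bigr => k _.
rewrite rmorphM /= cplx_invmx mulr_suml; apply: eq_bigr => a _.
by rewrite !mxE; ring.
Qed.

Lemma bil_schouten b c :
  bil (cplx_mx (\matrix_(j, k) schouten g Rm j k)) (E b) (E c) = frame_schouten L b c.
Proof.
have -> : cplx_mx (\matrix_(j, k) schouten g Rm j k) =
    2^-1 *: (cplx_mx (\matrix_(j, k) ricci g Rm j k)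
             - ((\sum_a frame_ricci L a (bar a)) / 6%:R) *: gC).
  apply/matrixP => i j; rewrite !mxE /schouten -cplx_scalar_curvature.
  by rewrite rmorphM rmorphB !rmorphM !fmorphV !rmorph_nat.
by have [EE _] := fE; rewrite bilZ bilD bilN bilZ bil_ricci EE.
Qed.

Lemma frame_components_weyl a b c d :
  frame_components (weyl g Rm) a b c d = frame_weyl L a b c d.
Proof.
pose P := \matrix_(j, k) schouten g Rm j k.
rewrite /frame_components.
rewrite (eq_cplx_tensor (T2 := fun i j k l => Rm i j k l
   + - (P i l * g j k + g i l * P j k + - (P i k * g j l) + - (g i k * P j l)))).
  rewrite !cplx_tensorD cplx_tensorN !cplx_tensorD !cplx_tensorN.
  rewrite !cplx_tensor_prod_14_23 !cplx_tensor_prod_13_24 !bil_schouten.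
  have [EE _] := fE; rewrite !EE /frame_weyl -/(frame_components Rm a b c d).
  ring.
by move=> i j k l; rewrite /weyl !mxE; ring.
Qed.

(** The projection to the anti-self-dual part only sees the components of z_1
/\ conj z_2, z_2 /\ conj z_1 and the difference of the components (1, conj 1)
and (2, conj 2). *)
Lemma weyl_minus_eq0 :
  (forall i j k l, weyl_minus g J Rm i j k l = 0) <->
  (forall c d, [/\ frame_weyl L o0 o3 c d = 0, frame_weyl L o1 o2 c d = 0 &
                   frame_weyl L o0 o2 c d = frame_weyl L o1 o3 c d]).
Proof.
have compE a b c d : frame_components (weyl_minus g J Rm) a b c d =
    2^-1 * (frame_weyl L a b c d
            - bil (hodge gC JC (slice (weyl g Rm) (E c) (E d))) (E a) (E b)).
  rewrite /frame_components cplx_tensor_slice slice_weyl_minus bilZ bilD bilN.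
  by rewrite -cplx_tensor_slice -frame_components_weyl.
have H c d := hodge_frame fE gCsym JCskew
  (slice_skew (E c) (E d) weyl_skew).
have two0 : (2 : C) != 0 by rewrite pnatr_eq0.
have two20 : (2^-1 : C) != 0 by rewrite invr_eq0.
have SW a b c d : bil (slice (weyl g Rm) (E c) (E d)) (E a) (E b) = frame_weyl L a b c d.
  by rewrite -cplx_tensor_slice -frame_components_weyl.
split=> [W0 c d | W0].
  have F0 a b : frame_components (weyl_minus g J Rm) a b c d = 0.
    rewrite /frame_components /cplx_tensor !big1 // => i _.
    by do 3 (rewrite big1 // => ? _); rewrite W0 !mul0r.
  have [/= h03 h12 [h02 h13] _] := H c d.
  move: (F0 o0 o3) (F0 o1 o2) (F0 o0 o2); rewrite !compE h03 h12 h02 !SW.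
  have half (x : C) : 2^-1 * (x - - x) = x by field.
  rewrite !half => -> ->.
  by move=> /eqP; rewrite mulf_eq0 (negbTE two20) subr_eq0 => /eqP ->.
apply: frame_components_eq0 => a b c d.
have Sskew := slice_skew (E c) (E d) weyl_skew.
have anti x y : frame_components (weyl_minus g J Rm) y x c d =
    - frame_components (weyl_minus g J Rm) x y c d.
  rewrite /frame_components !cplx_tensor_slice; apply: bil_skew.
  rewrite slice_weyl_minus linearZ linearB /= Sskew.
  by rewrite (hodge_skew fE gCsym JCskew Sskew) -scalerN opprB opprK addrC.
have diag x : frame_components (weyl_minus g J Rm) x x c d = 0.
  by apply/eqP; rewrite -eqNr -anti.
have [/= h03 h12 [h02 h13] [h01 h23]] := H c d; have [w03 w12 w] := W0 c d.
have z01 : frame_components (weyl_minus g J Rm) o0 o1 c d = 0.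
  by rewrite compE h01 SW subrr mulr0.
have z02 : frame_components (weyl_minus g J Rm) o0 o2 c d = 0.
  by rewrite compE h02 SW w subrr mulr0.
have z03 : frame_components (weyl_minus g J Rm) o0 o3 c d = 0.
  by rewrite compE h03 SW w03 oppr0 subrr mulr0.
have z12 : frame_components (weyl_minus g J Rm) o1 o2 c d = 0.
  by rewrite compE h12 SW w12 oppr0 subrr mulr0.
have z13 : frame_components (weyl_minus g J Rm) o1 o3 c d = 0.
  by rewrite compE h13 SW w subrr mulr0.
have z23 : frame_components (weyl_minus g J Rm) o2 o3 c d = 0.
  by rewrite compE h23 SW subrr mulr0.
by move: a b; do 2 elim/ord4_ind; rewrite ?diag // ?z01 ?z02 ?z03 ?z12 ?z13 ?z23 //
  anti ?z01 ?z02 ?z03 ?z12 ?z13 ?z23 oppr0.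
Qed.

End WeylFrame.

Section WeylConditions.
Variable (K : numFieldType) (L : 'I_4 -> 'I_4 -> 'I_4 -> 'I_4 -> K).
Hypothesis Lsym : riemann_symmetric L.

(** The trace-free part of the curvature on the three-dimensional space of
anti-self-dual forms, spanned by z_1 /\ conj z_2, z_2 /\ conj z_1 and z_1 /\
conj z_1 - z_2 /\ conj z_2: the five equations say that this symmetric form is
a multiple of the metric. All other components of the Weyl tensor in question
vanish by the Riemann symmetries. *)
Lemma frame_weyl_eq0 :
  (forall c d, [/\ frame_weyl L o0 o3 c d = 0, frame_weyl L o1 o2 c d = 0 &
                   frame_weyl L o0 o2 c d = frame_weyl L o1 o3 c d]) <->
  [/\ L o0 o3 o0 o3 = 0, L o1 o2 o1 o2 = 0, L o0 o2 o0 o3 = L o0 o3 o1 o3,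
      L o0 o2 o1 o2 = L o1 o2 o1 o3 &
      L o0 o2 o0 o2 + L o1 o3 o1 o3 - 2 * L o0 o2 o1 o3 = 2 * L o0 o3 o1 o2].
Proof.
have [R1 R2 R3 R4] := Lsym.
have D1 a k l : L a a k l = 0 by apply/eqP; rewrite -eqNr -R1.
have D2 a k l : L k l a a = 0 by apply/eqP; rewrite -eqNr -R2.
have B : L o0 o1 o2 o3 = L o0 o2 o1 o3 - L o0 o3 o1 o2.
  have := R4 o0 o1 o2 o3; rewrite (R1 o0 o2) (R3 o0 o3 o1 o2) => /eqP.
  by rewrite -addrA addr_eq0 opprB => /eqP ->.
(* Rewriting rules that bring every component to one of the 20 independent
   ones: ordered pairs, pairs in lexicographic order, and Bianchi. *)
pose canon1 := (D1, D2, R1 o0 o1, R1 o0 o2, R1 o0 o3, R1 o1 o2, R1 o1 o3, R1 o2 o3).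
pose canon2 := (fun k l => R2 k l o0 o1, fun k l => R2 k l o0 o2, fun k l => R2 k l o0 o3,
  fun k l => R2 k l o1 o2, fun k l => R2 k l o1 o3, fun k l => R2 k l o2 o3).
pose canon3 := (R3 o0 o1 o0 o2, R3 o0 o1 o0 o3, R3 o0 o1 o1 o2, R3 o0 o1 o1 o3,
  R3 o0 o1 o2 o3, R3 o0 o2 o0 o3, R3 o0 o2 o1 o2, R3 o0 o2 o1 o3, R3 o0 o2 o2 o3,
  R3 o0 o3 o1 o2, R3 o0 o3 o1 o3, R3 o0 o3 o2 o3, R3 o1 o2 o1 o3, R3 o1 o2 o2 o3,
  R3 o1 o3 o2 o3).
have canonE := (canon1, canon2, canon3, B).
split=> [W | [h1 h2 h3 h4 h5]].
- have w03 c d : frame_weyl L o0 o3 c d = 0 by have [] := W c d.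
  have w12 c d : frame_weyl L o1 o2 c d = 0 by have [] := W c d.
  have w c d : frame_weyl L o0 o2 c d - frame_weyl L o1 o3 c d = 0.
    by have [_ _ ->] := W c d; rewrite subrr.
  split.
  + rewrite -(w03 o0 o3) /frame_weyl /frame_schouten /frame_ricci !sum4 /= !canonE.
    by field.
  + rewrite -(w12 o1 o2) /frame_weyl /frame_schouten /frame_ricci !sum4 /= !canonE.
    by field.
  + apply/eqP; rewrite -subr_eq0 -(subrr (0 : K)) -{1}(w03 o0 o2) -(w03 o1 o3).
    rewrite /frame_weyl /frame_schouten /frame_ricci !sum4 /= !canonE.
    by apply/eqP; field.
  + apply/eqP; rewrite -subr_eq0 -(subrr (0 : K)) -{1}(w12 o0 o2) -(w12 o1 o3).
    rewrite /frame_weyl /frame_schouten /frame_ricci !sum4 /= !canonE.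
    by apply/eqP; field.
  + have E : L o0 o2 o0 o2 + L o1 o3 o1 o3 - 2 * L o0 o2 o1 o3 - 2 * L o0 o3 o1 o2 =
      (frame_weyl L o0 o2 o0 o2 - frame_weyl L o1 o3 o0 o2)
      - (frame_weyl L o0 o2 o1 o3 - frame_weyl L o1 o3 o1 o3)
      - 2 * frame_weyl L o0 o3 o1 o2.
      rewrite /frame_weyl /frame_schouten /frame_ricci !sum4 /= !canonE.
      by field.
    by apply/eqP; rewrite -subr_eq0 E !w w03 mulr0 !subr0.
have h5' : L o0 o3 o1 o2 =
    (L o0 o2 o0 o2 + L o1 o3 o1 o3 - 2 * L o0 o2 o1 o3) / 2 by rewrite h5; field.
have weyl_anti a b c d : frame_weyl L a b d c = - frame_weyl L a b c d.
  by rewrite /frame_weyl R2; ring.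
have weyl_diag a b c : frame_weyl L a b c c = 0.
  by apply/eqP; rewrite -eqNr -weyl_anti.
have weyl_lt (c d : 'I_4) : (c < d)%N -> [/\ frame_weyl L o0 o3 c d = 0,
    frame_weyl L o1 o2 c d = 0 & frame_weyl L o0 o2 c d = frame_weyl L o1 o3 c d].
  rewrite /frame_weyl /frame_schouten /frame_ricci.
  elim/ord4_ind: c; elim/ord4_ind: d => // _;
    by rewrite !sum4 /= !canonE ?h1 ?h2 ?h3 ?h4 ?h5'; split; field.
move=> c d; case: (ltngtP c d) => [/weyl_lt // | /weyl_lt [w1 w2 w3] | /val_inj <-].
  by rewrite ![frame_weyl L _ _ c d]weyl_anti w1 w2 w3 oppr0.
by rewrite !weyl_diag.
Qed.

End WeylConditions.

(** * The curvature difference acts on T10 by scalars *)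

Section LoweredEndomorphisms.
Variables (R : realType).
Notation C := R[i].

Lemma conj_bil (M : 'M[R]_4) X Y :
  conjc (bil (cplx_mx M) X Y) = bil (cplx_mx M) (conj_mx X) (conj_mx Y).
Proof.
rewrite !bilE rmorph_sum; apply: eq_bigr => i _; rewrite rmorph_sum.
by apply: eq_bigr => j _; rewrite !rmorphM !mxE [X in X * _ * _]conjc_real.
Qed.

Variables (g J : 'M[R]_4) (E : 'I_4 -> 'cV[C]_4).
Hypothesis gsym : g^T = g.
Hypothesis Jskew : J^T *m g = - (g *m J).
Hypothesis fE : adapted_frame (cplx_mx g) (cplx_mx J) E.
Hypothesis Ereal : forall a, conj_mx (E a) = E (bar a).

Definition lowered (A : 'M[R]_4) a b : C := bil (cplx_mx (g *m A)) (E a) (E b).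

Lemma conj_lowered A a b : conjc (lowered A a b) = lowered A (bar a) (bar b).
Proof. by rewrite /lowered conj_bil !Ereal. Qed.

Lemma loweredD A B a b : lowered (A + B) a b = lowered A a b + lowered B a b.
Proof. by rewrite /lowered mulmxDr /cplx_mx map_mxD bilD. Qed.

Lemma loweredN A a b : lowered (- A) a b = - lowered A a b.
Proof. by rewrite /lowered mulmxN /cplx_mx map_mxN bilN. Qed.

Lemma loweredM A B a b :
  lowered (A *m B) a b = \sum_c lowered A a c * lowered B (bar c) b.
Proof.
rewrite /lowered -(bil_insert fE) /cplx_mx -map_invmx -!map_mxM mulmxA.
have gu : g \in unitmx by have := frame_unitmx fE; rewrite /cplx_mx map_unitmx.
by rewrite -(mulmxA (g *m A)) (mulmxA (invmx g)) mulVmx // mul1mx.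
Qed.

Lemma loweredMJ A a b : lowered (A *m J) a b = eps R b * lowered A a b.
Proof.
have [_ JE] := fE.
by rewrite /lowered mulmxA /cplx_mx map_mxM bilM JE bilZr.
Qed.

Lemma loweredJM A a b : lowered (J *m A) a b = - (eps R a * lowered A a b).
Proof.
have [_ JE] := fE.
rewrite /lowered mulmxA -[g *m J]opprK -Jskew mulNmx -mulmxA.
by rewrite /cplx_mx map_mxN bilN map_mxM -map_trmx bilMl JE bilZl.
Qed.

Lemma iC_neqN : ('i%C == - 'i%C :> C) = false.
Proof. by rewrite eq_complex /= oppr0 eqxx /= -[_ == _]eq_sym eqNr oner_eq0. Qed.

Lemma lowered_skew A a b :
  skew_anticommuting g J A -> lowered A b a = - lowered A a b.
Proof.
move=> [_ Ag]; rewrite /lowered; apply: bil_skew.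
by rewrite /cplx_mx map_trmx trmx_mul gsym Ag map_mxN.
Qed.

Lemma lowered_diag A a : skew_anticommuting g J A -> lowered A a a = 0.
Proof. by move=> sA; apply/eqP; rewrite -eqNr -lowered_skew. Qed.

Lemma lowered_mixed A a b : skew_anticommuting g J A -> eps R a != eps R b ->
  lowered A a b = 0.
Proof.
move=> [AJ _] neq; apply/eqP; have := loweredMJ A a b.
rewrite AJ loweredN loweredJM opprK => /eqP; rewrite -subr_eq0 -mulrBl mulf_eq0.
by rewrite subr_eq0 (negbTE neq).
Qed.

(** The component of [M] from T10 to T10 is a multiple of the identity.
Lowered by [g], this component pairs z_1, z_2 with their conjugates. *)
Definition scalar_on_T10 (M : 'M[R]_4) :=
  [/\ lowered M o2 o1 = 0, lowered M o3 o0 = 0 & lowered M o3 o1 = lowered M o2 o0].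

(** In the frame, [A] exchanges T10 and its conjugate, and a skew 2 x 2 block
is determined by one number. So A B acts on T10 by the scalar a conj b up to
sign, where a and b are these numbers. *)
Lemma scalar_on_T10_product A B :
  skew_anticommuting g J A -> skew_anticommuting g J B ->
  scalar_on_T10 (A *m B) /\
  conjc (lowered (A *m B) o2 o0) = lowered (B *m A) o2 o0.
Proof.
move=> sA sB.
have mixed B' : skew_anticommuting g J B' -> (lowered B' o2 o0 = 0) *
    (lowered B' o2 o1 = 0) * (lowered B' o3 o0 = 0) * (lowered B' o3 o1 = 0).
  by move=> sB'; do !split; apply: lowered_mixed; rewrite // !epsE eq_sym iC_neqN.
have prod B1 B2 a b : lowered (B1 *m B2) a b =
    lowered B1 a o0 * lowered B2 o2 b + lowered B1 a o1 * lowered B2 o3 b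
    + lowered B1 a o2 * lowered B2 o0 b + lowered B1 a o3 * lowered B2 o1 b.
  by rewrite loweredM sum4.
rewrite /scalar_on_T10 !(prod A B) (prod B A).
rewrite !(mixed _ sA) !(mixed _ sB) !lowered_diag // !(mul0r, mulr0, add0r, addr0).
split; last first.
  rewrite rmorphM [X in X * _]conj_lowered [X in _ * X]conj_lowered mulrC.
  rewrite -[bar o0]/o2 -[bar o1]/o3 -[bar o2]/o0 -[bar o3]/o1.
  by rewrite (lowered_skew o1 o0 sA) (lowered_skew o2 o3 sB) mulNr mulrN opprK.
by split; rewrite // (lowered_skew o2 o3 sA) (lowered_skew o1 o0 sB) mulNr mulrN opprK.
Qed.

Lemma scalar_on_T10D M N :
  scalar_on_T10 M -> scalar_on_T10 N -> scalar_on_T10 (M + N).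
Proof.
by move=> [a b c] [a' b' c']; split; rewrite !loweredD ?a ?a' ?b ?b' ?c ?c' ?addr0.
Qed.

Lemma scalar_on_T10N M : scalar_on_T10 M -> scalar_on_T10 (- M).
Proof. by move=> [a b c]; split; rewrite !loweredN ?a ?b ?c ?oppr0. Qed.

(** On the pairing of T10 with its conjugate, D J + J D is 2 i times D,
because g J = - J^T g and J acts by -i on conjugates. *)
Lemma scalar_on_T10_anticommutator D M : D *m J + J *m D = M ->
  scalar_on_T10 M -> scalar_on_T10 D /\
  'i%C * 2 * lowered D o2 o0 = lowered M o2 o0.
Proof.
move=> DJ [a b c].
have low2 x y : eps R x = - 'i%C -> eps R y = 'i%C ->
    'i%C * 2 * lowered D x y = lowered M x y.
  by move=> ex ey; rewrite -DJ loweredD loweredMJ loweredJM ex ey; ring.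
have i2 : 'i%C * 2 != 0 :> C.
  by rewrite mulf_neq0 ?pnatr_eq0 // eq_complex /= eqxx oner_eq0.
split; last exact: low2.
by split; apply: (mulfI i2); rewrite ?mulr0 !low2.
Qed.

(** The difference of the two curvatures pairs T10 with its conjugate through
a multiple of the Hermitian product. Its commutator and anticommutator terms
are products of skew endomorphisms anticommuting with [J]; conjugation
exchanges the factors, which is the second assertion. *)
Lemma curvature_difference_scalar (A N : 'I_4 -> 'M[R]_4) (D : 'I_4 -> 'I_4 -> 'M[R]_4) :
  (forall i, skew_anticommuting g J (A i)) ->
  (forall i, skew_anticommuting g J (N i)) ->
  (forall i j, D i j *m J + J *m D i j = - (A j *m N i + N i *m A j)) ->
  let T i j := D i j - D j i + A i *m A j - A j *m A i in
  forall i j, scalar_on_T10 (T i j) /\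
    conjc (lowered (T i j) o2 o0) = lowered (T j i) o2 o0.
Proof.
move=> sA sN DJ T.
have sD i j : scalar_on_T10 (D i j) /\
    conjc (lowered (D i j) o2 o0) = - lowered (D i j) o2 o0.
  have [sAN cAN] := scalar_on_T10_product (sA j) (sN i).
  have [sNA cNA] := scalar_on_T10_product (sN i) (sA j).
  have [s ED] := scalar_on_T10_anticommutator (DJ i j)
    (scalar_on_T10N (scalar_on_T10D sAN sNA)).
  split=> //; have i2 : 'i%C * 2 != 0 :> C.
    by rewrite mulf_neq0 ?pnatr_eq0 // eq_complex /= eqxx oner_eq0.
  have c2 : conjc ('i%C * 2 : C) = - ('i%C * 2).
    by apply/eqP; rewrite eq_complex /=; apply/andP; split; apply/eqP; ring.
  apply: (mulfI i2); rewrite mulrN ED -[LHS]opprK -mulNr -c2 -rmorphM; congr (- _).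
  rewrite ED loweredN loweredD rmorphN rmorphD; congr (- _).
  by rewrite [X in X + _]cAN [X in _ + X]cNA addrC.
move=> i j; have [sAA cAA] := scalar_on_T10_product (sA i) (sA j).
have [sAA' cAA'] := scalar_on_T10_product (sA j) (sA i).
have [sDij cDij] := sD i j; have [sDji cDji] := sD j i.
split.
  exact: (scalar_on_T10D (scalar_on_T10D (scalar_on_T10D sDij (scalar_on_T10N sDji))
    sAA) (scalar_on_T10N sAA')).
have TE k l : lowered (T k l) o2 o0 = lowered (D k l) o2 o0 - lowered (D l k) o2 o0
    + lowered (A k *m A l) o2 o0 - lowered (A l *m A k) o2 o0.
  by rewrite /T 3!loweredD 2!loweredN.
have conj_swap (a b c d : C) : conjc a = - a -> conjc b = - b -> conjc c = d ->
    conjc d = c -> conjc (a - b + c - d) = b - a + d - c.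
  by move=> ha hb hc hd; rewrite !rmorphD !rmorphN /= ha hb hc hd; ring.
apply: (etrans (congr1 _ (TE i j))); apply: etrans (esym (TE j i)).
exact: conj_swap.
Qed.

Lemma cplx_tensor_lowered (T : 'I_4 -> 'I_4 -> 'M[R]_4) X Y c d :
  cplx_tensor (fun i j k l => (g *m T i j) l k) X Y (E c) (E d) =
  \sum_i \sum_j X i 0 * Y j 0 * lowered (T i j) d c.
Proof.
rewrite /cplx_tensor; apply: eq_bigr => i _; apply: eq_bigr => j _.
rewrite /lowered bilE exchange_big mulr_sumr; apply: eq_bigr => l _.
by rewrite mulr_sumr; apply: eq_bigr => k _; rewrite !mxE; ring.
Qed.

End LoweredEndomorphisms.

(** * Constant holomorphic sectional curvature in a unitary frame *)

Section ConstantCurvature.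
Variable R : realType.
Notation C := R[i].

(** A polynomial in [t] and its conjugate that vanishes identically has zero
coefficients. *)
Lemma quartic_coefficients (k c1 c2 c3 c4 c5 c6 c7 : C) :
  (forall t : C, let s := conjc t in
     k + t * c1 + s * c2 + t * t * c3 + s * s * c4 + t * s * c5
     + t * t * s * c6 + t * s * s * c7 + t * t * s * s * k
     = k * ((1 + t * s) * (1 + t * s))) ->
  [/\ c1 = 0, c2 = 0, c3 = 0, c4 = 0 & [/\ c5 = 2 * k, c6 = 0 & c7 = 0]].
Proof.
move=> H.
(* Evaluation at 1, -1, 2, -2 and i times these separates the coefficients by
   parity and degree; 1 + i then separates those of t^2 and conj t^2. *)
have split2 (z w : C) : z = w -> complex.Re z = complex.Re w /\ complex.Im z = complex.Im w by move=> ->.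
have [p1 q1] := split2 _ _ (H (1 +i* 0)).
have [p2 q2] := split2 _ _ (H ((-1) +i* 0)).
have [p3 q3] := split2 _ _ (H (2 +i* 0)).
have [p4 q4] := split2 _ _ (H ((-2) +i* 0)).
have [p5 q5] := split2 _ _ (H (0 +i* 1)).
have [p6 q6] := split2 _ _ (H (0 +i* (-1))).
have [p7 q7] := split2 _ _ (H (0 +i* 2)).
have [p8 q8] := split2 _ _ (H (0 +i* (-2))).
have [p9 q9] := split2 _ _ (H (1 +i* 1)).
clear H.
case: k c1 c2 c3 c4 c5 c6 c7 p1 q1 p2 q2 p3 q3 p4 q4 p5 q5 p6 q6 p7 q7 p8 q8 p9 q9
  => [k k'] [a1 b1] [a2 b2] [a3 b3] [a4 b4] [a5 b5] [a6 b6] [a7 b7] /=.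
move=> p1 q1 p2 q2 p3 q3 p4 q4 p5 q5 p6 q6 p7 q7 p8 q8 p9 q9.
have eqc (x y x' y' : R) : x = x' -> y = y' -> x +i* y = x' +i* y' by move=> -> ->.
have [e1 o1] : a3 + a4 + a5 = 2 * k /\ a1 + a2 + a6 + a7 = 0.
  by clear -p1 p2; lra.
have [e1' o1'] : b3 + b4 + b5 = 2 * k' /\ b1 + b2 + b6 + b7 = 0.
  by clear -q1 q2; lra.
have o2 : 2 * (a1 + a2) + 8 * (a6 + a7) = 0 by clear -p3 p4; lra.
have o2' : 2 * (b1 + b2) + 8 * (b6 + b7) = 0 by clear -q3 q4; lra.
have [e3 o3'] : a5 - a3 - a4 = 2 * k /\ b1 - b2 + b6 - b7 = 0.
  by clear -p5 p6; lra.
have [e3' o3] : b5 - b3 - b4 = 2 * k' /\ a1 - a2 + a6 - a7 = 0.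
  by clear -q5 q6; lra.
have o4' : 2 * (b1 - b2) + 8 * (b6 - b7) = 0 by clear -p7 p8; lra.
have o4 : 2 * (a1 - a2) + 8 * (a6 - a7) = 0 by clear -q7 q8; lra.
clear p1 q1 p2 q2 p3 q3 p4 q4 p5 q5 p6 q6 p7 q7 p8 q8.
have a1E : a1 = 0 by lra.
have a2E : a2 = 0 by lra.
have a5E : a5 = 2 * k by lra.
have a6E : a6 = 0 by lra.
have a7E : a7 = 0 by lra.
have b1E : b1 = 0 by lra.
have b2E : b2 = 0 by lra.
have b5E : b5 = 2 * k' by lra.
have b6E : b6 = 0 by lra.
have b7E : b7 = 0 by lra.
have [a3E a4E] : a3 = 0 /\ a4 = 0 by subst; clear -e1 q9; lra.
have [b3E b4E] : b3 = 0 /\ b4 = 0 by subst; clear -e1' p9; lra.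
by subst; split; [..| split]; apply: eqc => //; ring.
Qed.

End ConstantCurvature.

Section UnitaryFrames.
Variables (R : realType).
Notation C := R[i].
Variables (g J : 'M[R]_4).
Hypothesis gsym : g^T = g.
Hypothesis Jskew : J^T *m g = - (g *m J).

Definition frame_of (z : 'I_2 -> 'cV[C]_4) (a : 'I_4) : 'cV[C]_4 :=
  match val a with
  | 0 => z ord0 | 1 => z ord_max | 2 => conj_mx (z ord0) | _ => conj_mx (z ord_max)
  end.

Lemma conj_mxK m n : involutive (@conj_mx R m n).
Proof. by move=> A; apply/matrixP => i j; rewrite !mxE conjcK. Qed.

Lemma conj_mxD m n (A B : 'M[C]_(m, n)) : conj_mx (A + B) = conj_mx A + conj_mx B.
Proof. by rewrite /conj_mx map_mxD. Qed.

Lemma conj_mxZ m n k (A : 'M[C]_(m, n)) : conj_mx (k *: A) = conjc k *: conj_mx A.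
Proof. by rewrite /conj_mx map_mxZ. Qed.

Lemma conj_cplx_mulmx (A : 'M[R]_4) (Z : 'cV[C]_4) :
  conj_mx (cplx_mx A *m Z) = cplx_mx A *m conj_mx Z.
Proof.
rewrite /conj_mx map_mxM; congr (_ *m _); apply/matrixP => i j.
by rewrite !mxE; exact: conjc_real.
Qed.

Lemma T10_conj Z : T10 J Z -> cplx_mx J *m conj_mx Z = - 'i%C *: conj_mx Z.
Proof.
rewrite /T10 => JZ; rewrite -conj_cplx_mulmx JZ conj_mxZ; congr (_ *: _).
by apply/eqP; rewrite eq_complex /= oppr0 !eqxx.
Qed.

(** J is orthogonal and acts by i on both arguments, so g(Z, W) = -g(Z, W). *)
Lemma T10_isotropic Z W : T10 J Z -> T10 J W -> bil (cplx_mx g) Z W = 0.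
Proof.
move=> JZ JW.
have : bil (cplx_mx g) (cplx_mx J *m Z) W = - bil (cplx_mx g) Z (cplx_mx J *m W).
  by rewrite -bilMl -bilM -bilN; congr (bil _ _ _); apply: JCskew.
rewrite JZ JW bilZl bilZr => /eqP; rewrite -addr_eq0 -mulrDl mulf_eq0.
by rewrite -mulr2n mulrn_eq0 eq_complex /= oner_eq0 andbF => /eqP.
Qed.

Lemma frame_of_conj z a : conj_mx (frame_of z a) = frame_of z (bar a).
Proof. by elim/ord4_ind: a; rewrite /frame_of /= ?conj_mxK. Qed.

Lemma frame_of_adapted z : unitary_frame g J z ->
  adapted_frame (cplx_mx g) (cplx_mx J) (frame_of z).
Proof.
move=> [z10 zz].
have zzb a b : bil (cplx_mx g) (z a) (conj_mx (z b)) = (a == b)%:R := zz a b.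
have zbz a b : bil (cplx_mx g) (conj_mx (z b)) (z a) = (a == b)%:R.
  by rewrite -zzb -bil_tr (gCsym gsym).
have z0 a b : bil (cplx_mx g) (z a) (z b) = 0 by apply: T10_isotropic.
have zb0 a b : bil (cplx_mx g) (conj_mx (z a)) (conj_mx (z b)) = 0.
  by rewrite -conj_bil z0 conjc0.
split.
  by elim/ord4_ind; elim/ord4_ind; rewrite /frame_of /= ?zzb ?zbz ?z0 ?zb0.
by elim/ord4_ind; rewrite /frame_of ?epsE /=; (apply: z10 || apply: T10_conj).
Qed.

(** The coefficients along the conjugate vectors vanish because T10 is
isotropic. *)
Lemma T10_frame (z : 'I_2 -> 'cV[C]_4) Z : unitary_frame g J z -> T10 J Z ->
  exists u v, Z = u *: z ord0 + v *: z ord_max.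
Proof.
move=> zU Z10; have fz := frame_of_adapted zU.
exists (bil (cplx_mx g) (conj_mx (z ord0)) Z), (bil (cplx_mx g) (conj_mx (z ord_max)) Z).
rewrite {1}(frame_decomposition fz Z) sum4 /frame_of /=.
have [z10 _] := zU.
by rewrite (T10_isotropic (z10 ord0) Z10) (T10_isotropic (z10 ord_max) Z10) !scale0r !addr0.
Qed.

End UnitaryFrames.

Section Multilinearity.
Variables (R : realType).
Implicit Types (T : 'I_4 -> 'I_4 -> 'I_4 -> 'I_4 -> R) (a b : R[i]).

Lemma cplx_tensor_lin1 T a b X X' Y Z W : cplx_tensor T (a *: X + b *: X') Y Z W =
  a * cplx_tensor T X Y Z W + b * cplx_tensor T X' Y Z W.
Proof. by rewrite cplx_tensor_Dl !cplx_tensor_Zl. Qed.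

Lemma cplx_tensor_lin2 T a b X Y Y' Z W : cplx_tensor T X (a *: Y + b *: Y') Z W =
  a * cplx_tensor T X Y Z W + b * cplx_tensor T X Y' Z W.
Proof. by rewrite -!(cplx_tensor_swap12 T) cplx_tensor_lin1. Qed.

Lemma cplx_tensor_lin3 T a b X Y Z Z' W : cplx_tensor T X Y (a *: Z + b *: Z') W =
  a * cplx_tensor T X Y Z W + b * cplx_tensor T X Y Z' W.
Proof. by rewrite -!(cplx_tensor_swap23 T) cplx_tensor_lin2. Qed.

Lemma cplx_tensor_lin4 T a b X Y Z W W' : cplx_tensor T X Y Z (a *: W + b *: W') =
  a * cplx_tensor T X Y Z W + b * cplx_tensor T X Y Z W'.
Proof. by rewrite -!(cplx_tensor_swap34 T) cplx_tensor_lin3. Qed.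

End Multilinearity.

Section ConstantCurvatureFrame.
Variables (R : realType).
Notation C := R[i].
Variables (g J : 'M[R]_4) (T : 'I_4 -> 'I_4 -> 'I_4 -> 'I_4 -> R).
Variable z : 'I_2 -> 'cV[C]_4.
Hypothesis gsym : g^T = g.
Hypothesis Jskew : J^T *m g = - (g *m J).
Hypothesis zU : unitary_frame g J z.
Notation K := (frame_components (frame_of z) T).

Lemma herm_frame u v : herm g (u *: z ord0 + v *: z ord_max)
  (u *: z ord0 + v *: z ord_max) = u * conjc u + v * conjc v.
Proof.
have [_ zz] := zU.
have zzb a b : bil (cplx_mx g) (z a) (conj_mx (z b)) = (a == b)%:R := zz a b.
rewrite -[LHS]/(bil _ _ (conj_mx _)) conj_mxD !conj_mxZ.
rewrite !(bilDl, bilDr, bilZl, bilZr) !zzb /=; ring.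
Qed.

Lemma curvature_frame u v :
  let Z := u *: z ord0 + v *: z ord_max in
  let s := conjc u in let t := conjc v in
  cplx_tensor T Z (conj_mx Z) Z (conj_mx Z) =
  u * u * s * s * K o0 o2 o0 o2
  + u * v * s * s * (K o1 o2 o0 o2 + K o0 o2 o1 o2)
  + u * u * s * t * (K o0 o3 o0 o2 + K o0 o2 o0 o3)
  + v * v * s * s * K o1 o2 o1 o2 + u * u * t * t * K o0 o3 o0 o3
  + u * v * s * t * (K o0 o2 o1 o3 + K o0 o3 o1 o2 + K o1 o2 o0 o3 + K o1 o3 o0 o2)
  + v * v * s * t * (K o1 o3 o1 o2 + K o1 o2 o1 o3)
  + u * v * t * t * (K o1 o3 o0 o3 + K o0 o3 o1 o3)
  + v * v * t * t * K o1 o3 o1 o3.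
Proof.
move=> Z s t; rewrite /Z conj_mxD !conj_mxZ.
rewrite !(cplx_tensor_lin1, cplx_tensor_lin2, cplx_tensor_lin3, cplx_tensor_lin4).
rewrite /frame_components /frame_of /= -/s -/t; ring.
Qed.

(** On Z = u z_1 + v z_2 the numerator of the holomorphic sectional curvature
is a polynomial in u, v and their conjugates. It equals k h(Z, Z)^2 if and
only if the coefficients agree. *)
Lemma constant_hol_sec_curvP :
  constant_hol_sec_curv g J T <->
  exists k : R, [/\ K o0 o2 o0 o2 = k%:C, K o1 o3 o1 o3 = k%:C,
    K o0 o3 o0 o3 = 0 /\ K o1 o2 o1 o2 = 0,
    K o1 o2 o0 o2 + K o0 o2 o1 o2 = 0 /\ K o0 o3 o0 o2 + K o0 o2 o0 o3 = 0 &
    [/\ K o1 o3 o1 o2 + K o1 o2 o1 o3 = 0, K o1 o3 o0 o3 + K o0 o3 o1 o3 = 0 &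
    K o0 o2 o1 o3 + K o0 o3 o1 o2 + K o1 o2 o0 o3 + K o1 o3 o0 o2 = 2 * k%:C]].
Proof.
have [z10 zz] := zU.
have Z10 u v : T10 J (u *: z ord0 + v *: z ord_max).
  rewrite /T10 mulmxDr -!scalemxAr (z10 ord0) (z10 ord_max) scalerDr !scalerA.
  by rewrite mulrC [v * _]mulrC.
have norm0 (u v : C) : u * conjc u + v * conjc v = 0 -> u = 0 /\ v = 0.
  move/eqP; rewrite paddr_eq0 ?mulcJ_ge0 // !mulf_eq0 !conjc_eq0 !orbb.
  by move=> /andP[/eqP -> /eqP ->].
split=> [[k H] | [k [h1 h2 [h3 h4] [h5 h6] [h7 h8 h9]]]]; exists k.
  have Hk u v : (u != 0) || (v != 0) ->
      cplx_tensor T (u *: z ord0 + v *: z ord_max)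
        (conj_mx (u *: z ord0 + v *: z ord_max)) (u *: z ord0 + v *: z ord_max)
        (conj_mx (u *: z ord0 + v *: z ord_max))
      = k%:C * (u * conjc u + v * conjc v) ^+ 2.
    move=> uv; have nz : u * conjc u + v * conjc v != 0.
      apply/eqP => /norm0 [u0 v0]; move: uv; by rewrite u0 v0 eqxx.
    have Znz : u *: z ord0 + v *: z ord_max != 0.
      apply: contraNneq nz => Z0; rewrite -herm_frame Z0 /herm linear0 !mul0mx.
      by rewrite mxE.
    have := H _ (Z10 u v) Znz; rewrite /hol_sec_curv herm_frame => <-.
    by rewrite divfK // expf_neq0.
  have K0 : K o0 o2 o0 o2 = k%:C.
    have := Hk 1 0; rewrite curvature_frame oner_eq0 => /(_ isT).
    rewrite conjc1 conjc0 !(mul1r, mulr1, mul0r, mulr0, addr0) => ->.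
    by rewrite expr1n mulr1.
  have K1 : K o1 o3 o1 o3 = k%:C.
    have := Hk 0 1; rewrite curvature_frame oner_eq0 orbT => /(_ isT).
    rewrite conjc1 conjc0 !(mul1r, mulr1, mul0r, mulr0, addr0, add0r) => ->.
    by rewrite expr1n mulr1.
  have [|c1 c2 c3 c4 [c5 c6 c7]] := @quartic_coefficients R k%:C
    (K o1 o2 o0 o2 + K o0 o2 o1 o2) (K o0 o3 o0 o2 + K o0 o2 o0 o3)
    (K o1 o2 o1 o2) (K o0 o3 o0 o3)
    (K o0 o2 o1 o3 + K o0 o3 o1 o2 + K o1 o2 o0 o3 + K o1 o3 o0 o2)
    (K o1 o3 o1 o2 + K o1 o2 o1 o3) (K o1 o3 o0 o3 + K o0 o3 o1 o3).
    move=> t s; have := Hk 1 t; rewrite curvature_frame oner_eq0 => /(_ isT).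
    rewrite conjc1 K0 K1 -/s !(mul1r, mulr1) => H1.
    by rewrite -expr2 -[RHS]H1; ring.
  by split.
move=> Z Z10' Znz; have [u [v ZE]] := T10_frame gsym Jskew zU Z10'.
have nz : u * conjc u + v * conjc v != 0.
  apply: contraNneq Znz => /norm0 [u0 v0].
  by rewrite ZE u0 v0 !scale0r addr0.
rewrite /hol_sec_curv ZE herm_frame curvature_frame h1 h2 h3 h4 h5 h6 h7 h8 h9.
have -> : forall a : C, a / (u * conjc u + v * conjc v) ^+ 2 = k%:C <->
  a = k%:C * (u * conjc u + v * conjc v) ^+ 2.
  move=> a; split=> [<-|->]; first by rewrite divfK // expf_neq0.
  by rewrite mulfK // expf_neq0.
ring.
Qed.

End ConstantCurvatureFrame.

(** * The two Ricci forms in a unitary frame *)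

Section RicciForms.
Variables (R : realType).
Notation C := R[i].

Lemma sum2 (V : nmodType) (F : 'I_2 -> V) : \sum_a F a = F ord0 + F ord_max.
Proof.
rewrite !big_ord_recr big_ord0 /= add0r.
by congr (_ + _); congr F; apply: val_inj.
Qed.

Lemma bil_wedge11 (a b : 'rV[C]_4) X Y : bil (wedge11 a b) X Y =
  (a *m X) 0 0 * (b *m Y) 0 0 - (b *m X) 0 0 * (a *m Y) 0 0.
Proof.
have E (c d : 'rV[C]_4) : bil (c^T *m d) X Y = (c *m X) 0 0 * (d *m Y) 0 0.
  rewrite /bil mulmxA -mulmxA -trmx_mul mxE big_ord1 [_^T _ _]mxE.
  by [].
by rewrite /wedge11 bilD bilN !E.
Qed.

Lemma wedge11_skew (a b : 'rV[C]_4) : (wedge11 a b)^T = - wedge11 a b.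
Proof. by rewrite /wedge11 linearB /= !trmx_mul !trmxK opprB. Qed.

Lemma bil_sum (I : finType) (F : I -> 'M[C]_4) X Y :
  bil (\sum_i F i) X Y = \sum_i bil (F i) X Y.
Proof. by rewrite /bil mulmx_sumr mulmx_suml summxE. Qed.

Lemma frame_bil_ext (g J M N : 'M[C]_4) (E : 'I_4 -> 'cV[C]_4) :
  adapted_frame g J E -> (forall a b, bil M (E a) (E b) = bil N (E a) (E b)) ->
  M = N.
Proof.
move=> fE MN.
have H1 X b : bil M X (E b) = bil N X (E b).
  by rewrite (frame_decomposition fE X) sum4 !bilDl !bilZl !MN.
have H2 X Y : bil M X Y = bil N X Y.
  by rewrite (frame_decomposition fE Y) sum4 !bilDr !bilZr !H1.
apply/matrixP => i j; have := H2 (delta_mx i 0) (delta_mx j 0).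
by rewrite /bil !trmx_delta -!rowE -!colE !mxE.
Qed.

Lemma skew_ext (F G : 'I_4 -> 'I_4 -> C) :
  (forall a b, F b a = - F a b) -> (forall a b, G b a = - G a b) ->
  F o0 o1 = G o0 o1 -> F o0 o2 = G o0 o2 -> F o0 o3 = G o0 o3 ->
  F o1 o2 = G o1 o2 -> F o1 o3 = G o1 o3 -> F o2 o3 = G o2 o3 ->
  forall a b, F a b = G a b.
Proof.
move=> Fskew Gskew e01 e02 e03 e12 e13 e23.
have anti a b : F a b = G a b -> F b a = G b a by move=> e; rewrite Fskew Gskew e.
have diag a : F a a = G a a.
  have F0 : F a a = 0 by apply/eqP; rewrite -eqNr -Fskew.
  by have G0 : G a a = 0; [apply/eqP; rewrite -eqNr -Gskew | rewrite F0 G0].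
by elim/ord4_ind; elim/ord4_ind; first [exact: diag | assumption | exact: anti].
Qed.

Variables (g J : 'M[R]_4) (T : 'I_4 -> 'I_4 -> 'I_4 -> 'I_4 -> R).
Variables (z : 'I_2 -> 'cV[C]_4) (zeta : 'I_2 -> 'rV[C]_4).
Hypothesis gsym : g^T = g.
Hypothesis Jskew : J^T *m g = - (g *m J).
Hypothesis zU : unitary_frame g J z.
Hypothesis zD : dual_coframe z zeta.
Notation K := (frame_components (frame_of z) T).
Notation E := (frame_of z).

Lemma coframe_conj a (X : 'cV[C]_4) :
  (conj_mx (zeta a) *m conj_mx X) 0 0 = conjc ((zeta a *m X) 0 0).
Proof. by rewrite /conj_mx -map_mxM mxE. Qed.

Lemma coframe_values a b :
  [/\ (zeta a *m z b) 0 0 = (a == b)%:R, (zeta a *m conj_mx (z b)) 0 0 = 0,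
      (conj_mx (zeta a) *m conj_mx (z b)) 0 0 = (a == b)%:R &
      (conj_mx (zeta a) *m z b) 0 0 = 0].
Proof.
have [h1 h2] := zD a b; split=> //.
  by rewrite coframe_conj h1 conjc_nat.
by rewrite -[z b]conj_mxK coframe_conj h2 conjc0.
Qed.

Lemma bil_coframe_sum (f : 'I_2 -> 'I_2 -> C) x y :
  bil (\sum_a \sum_b f a b *: wedge11 (zeta a) (conj_mx (zeta b))) x y =
  \sum_a \sum_b f a b * ((zeta a *m x) 0 0 * (conj_mx (zeta b) *m y) 0 0
    - (conj_mx (zeta b) *m x) 0 0 * (zeta a *m y) 0 0).
Proof.
rewrite bil_sum; apply: eq_bigr => a _; rewrite bil_sum; apply: eq_bigr => b _.
by rewrite bilZ bil_wedge11.
Qed.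

(** The common shape of the two Ricci forms, with coefficient matrix [f] on
z^a /\ conj z^b. *)
Definition coframe_form (f : 'I_2 -> 'I_2 -> C) : 'M[C]_4 :=
  'i%C *: \sum_a \sum_b f a b *: wedge11 (zeta a) (conj_mx (zeta b)).

Lemma coframe_form_skew f : (coframe_form f)^T = - coframe_form f.
Proof.
rewrite /coframe_form linearZ /= -scalerN linear_sum -sumrN; congr (_ *: _).
apply: eq_bigr => a _; rewrite linear_sum -sumrN; apply: eq_bigr => b _ /=.
by rewrite linearZ /= wedge11_skew scalerN.
Qed.

Lemma bil_coframe_form f : let B x y := bil (coframe_form f) (E x) (E y) in
  [/\ B o0 o2 = 'i%C * f ord0 ord0, B o1 o3 = 'i%C * f ord_max ord_max,
      B o0 o3 = 'i%C * f ord0 ord_max /\ B o1 o2 = 'i%C * f ord_max ord0 &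
      B o0 o1 = 0 /\ B o2 o3 = 0].
Proof.
move=> B; rewrite /B.
have ev x y (u : 'I_2 -> C) (v : 'I_2 -> C) (u' v' : 'I_2 -> C) :
    (forall a, (zeta a *m x) 0 0 = u a) -> (forall a, (zeta a *m y) 0 0 = v a) ->
    (forall a, (conj_mx (zeta a) *m x) 0 0 = u' a) ->
    (forall a, (conj_mx (zeta a) *m y) 0 0 = v' a) ->
    bil (coframe_form f) x y =
    'i%C * \sum_a \sum_b f a b * (u a * v' b - u' b * v a).
  move=> hu hv hu' hv'; rewrite bilZ bil_coframe_sum; congr (_ * _).
  by apply: eq_bigr => a _; apply: eq_bigr => b _; rewrite hu hv hu' hv'.
have zE a b : (zeta b *m z a) 0 0 = (b == a)%:R by have [] := coframe_values b a.
have zE' a b : (zeta b *m conj_mx (z a)) 0 0 = 0 by have [] := coframe_values b a.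
have cE a b : (conj_mx (zeta b) *m z a) 0 0 = 0 by have [] := coframe_values b a.
have cE' a b : (conj_mx (zeta b) *m conj_mx (z a)) 0 0 = (b == a)%:R.
  by have [] := coframe_values b a.
rewrite (ev _ _ _ _ _ _ (zE ord0) (zE' ord0) (cE ord0) (cE' ord0)).
rewrite (ev _ _ _ _ _ _ (zE ord_max) (zE' ord_max) (cE ord_max) (cE' ord_max)).
rewrite (ev _ _ _ _ _ _ (zE ord0) (zE' ord_max) (cE ord0) (cE' ord_max)).
rewrite (ev _ _ _ _ _ _ (zE ord_max) (zE' ord0) (cE ord_max) (cE' ord0)).
rewrite (ev _ _ _ _ _ _ (zE ord0) (zE ord_max) (cE ord0) (cE ord_max)).
rewrite (ev _ _ _ _ _ _ (zE' ord0) (zE' ord_max) (cE' ord0) (cE' ord_max)).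
by rewrite !sum2 /=; split; [| |split|split]; ring.
Qed.

Lemma ricci_rhoE : ricci_rho T z zeta = coframe_form (fun a b =>
  \sum_c cplx_tensor T (z a) (conj_mx (z b)) (z c) (conj_mx (z c))).
Proof.
congr (_ *: _); apply: eq_bigr => a _; apply: eq_bigr => b _.
by rewrite scaler_suml.
Qed.

Lemma ricci_rE : ricci_r T z zeta = coframe_form (fun a b =>
  \sum_c cplx_tensor T (z c) (conj_mx (z c)) (z a) (conj_mx (z b))).
Proof.
congr (_ *: _); rewrite exchange_big; apply: eq_bigr => a _ /=.
by rewrite exchange_big; apply: eq_bigr => b _; rewrite scaler_suml.
Qed.

(** Compare frame components with [hodge_frame]. The second and third
equations are * rho = r along z_1 /\ conj z_2 and its conjugate type; along
z_1 /\ conj z_1 and z_2 /\ conj z_2 the mixed components cancel and both give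
the first equation. *)
Lemma hodge_ricciP :
  hodge (cplx_mx g) (cplx_mx J) (ricci_rho T z zeta) = ricci_r T z zeta <->
  [/\ K o1 o3 o1 o3 = K o0 o2 o0 o2,
      K o0 o3 o0 o2 + K o0 o3 o1 o3 + K o0 o2 o0 o3 + K o1 o3 o0 o3 = 0 &
      K o1 o2 o0 o2 + K o1 o2 o1 o3 + K o0 o2 o1 o2 + K o1 o3 o1 o2 = 0].
Proof.
have fz := frame_of_adapted gsym Jskew zU.
have rho_skew : (ricci_rho T z zeta)^T = - ricci_rho T z zeta.
  by rewrite ricci_rhoE coframe_form_skew.
have [h03 h12 [h02 h13] [h01 h23]] :=
  hodge_frame fz (gCsym gsym) (JCskew Jskew) rho_skew.
have hskew := hodge_skew fz (gCsym gsym) (JCskew Jskew) rho_skew.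
have rskew : (ricci_r T z zeta)^T = - ricci_r T z zeta.
  by rewrite ricci_rE coframe_form_skew.
have := bil_coframe_form (fun a b =>
  \sum_c cplx_tensor T (z a) (conj_mx (z b)) (z c) (conj_mx (z c))).
rewrite -ricci_rhoE !sum2 => -[r02 r13 [r03 r12] [r01 r23]].
have := bil_coframe_form (fun a b =>
  \sum_c cplx_tensor T (z c) (conj_mx (z c)) (z a) (conj_mx (z b))).
rewrite -ricci_rE !sum2 => -[s02 s13 [s03 s12] [s01 s23]].
move: h03 h12 h02 h13 h01 h23; rewrite r03 r12 r02 r13 r01 r23.
move: (hodge _ _ _) (ricci_r _ _ _) hskew rskew s02 s13 s03 s12 s01 s23.
move=> M N Mskew Nskew s02 s13 s03 s12 s01 s23 h03 h12 h02 h13 h01 h23.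
have i0 : 'i%C != 0 :> C by rewrite eq_complex /= eqxx oner_eq0.
rewrite /frame_components /frame_of /=.
split=> [MN | [e1 e2 e3]].
  move: h03 h12 h02; rewrite MN s03 s12 s02 -!mulrN.
  move=> /(mulfI i0) e03 /(mulfI i0) e12 /(mulfI i0) e02; split.
  - have cancel (u v w : C) : u + v = w + u -> v = w by rewrite addrC; apply: addIr.
    exact: cancel (esym e02).
  - by rewrite -addrA e03 subrr.
  - by rewrite -addrA e12 subrr.
apply: (frame_bil_ext fz).
have w01 : bil M (E o0) (E o1) = bil N (E o0) (E o1) by rewrite h01 s01.
have w23 : bil M (E o2) (E o3) = bil N (E o2) (E o3) by rewrite h23 s23.
have w02 : bil M (E o0) (E o2) = bil N (E o0) (E o2).
  by rewrite h02 s02 e1 addrC.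
have w13 : bil M (E o1) (E o3) = bil N (E o1) (E o3).
  by rewrite h13 s13 e1 addrC.
have move_neg (u v w t : C) : u + v + w + t = 0 -> - (u + v) = w + t.
  by rewrite -addrA => /eqP; rewrite addr_eq0 => /eqP ->; rewrite opprK.
have w03 : bil M (E o0) (E o3) = bil N (E o0) (E o3).
  rewrite h03 s03 -mulrN; congr (_ * _).
  exact: move_neg e2.
have w12 : bil M (E o1) (E o2) = bil N (E o1) (E o2).
  rewrite h12 s12 -mulrN; congr (_ * _).
  exact: move_neg e3.
exact: (@skew_ext (fun a b => bil M (E a) (E b)) (fun a b => bil N (E a) (E b))
  (fun a b => bil_skew (E a) (E b) Mskew) (fun a b => bil_skew (E a) (E b) Nskew)
  w01 w02 w03 w12 w13 w23).
Qed.

End RicciForms.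

(** * Existence of unitary frames *)

Section FrameExistence.
Variables (R : realType).
Notation C := R[i].
Variables (g J : 'M[R]_4).
Hypothesis gsym : g^T = g.
Hypothesis gpos : forall X : 'cV[R]_4, X != 0 -> 0 < (X^T *m g *m X) 0 0.
Hypothesis Jsqr : J *m J = - 1%:M.
Hypothesis Jskew : J^T *m g = - (g *m J).

Let r (X Y : 'cV[R]_4) : R := (X^T *m g *m Y) 0 0.

Lemma inner_sym X Y : r X Y = r Y X.
Proof.
have E : X^T *m g *m Y = (Y^T *m g *m X)^T by rewrite !trmx_mul trmxK gsym mulmxA.
by rewrite /r E [LHS]mxE.
Qed.

Lemma inner_acs X Y : r X (J *m Y) = - r (J *m X) Y.
Proof.
have E : (J *m X)^T *m g *m Y = - (X^T *m g *m (J *m Y)).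
  by rewrite trmx_mul -(mulmxA X^T J^T) Jskew mulmxN mulNmx !mulmxA.
by rewrite /r E oppmxE opprK.
Qed.

Lemma inner_acs_diag X : r (J *m X) X = 0.
Proof. by apply/eqP; rewrite -eqNr -inner_acs inner_sym. Qed.

Lemma inner_acs2 X Y : r (J *m X) (J *m Y) = r X Y.
Proof.
rewrite -[LHS]opprK -inner_acs mulmxA Jsqr mulNmx mul1mx /r mulmxN oppmxE; ring.
Qed.

Lemma inner_scale k X Y : r X (k *: Y) = k * r X Y.
Proof. by rewrite /r -scalemxAr mxE. Qed.

Lemma normalize X : X != 0 -> exists k, r (k *: X) (k *: X) = 1.
Proof.
move=> /gpos X0; exists (Num.sqrt (r X X))^-1.
rewrite inner_scale inner_sym inner_scale mulrA -invfM -expr2 sqr_sqrtr ?ltW //.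
by rewrite mulVf // gt_eqF.
Qed.

(** The endomorphism [P] built from a unit vector X and J X has rank at most
2, so some basis vector has a nonzero component orthogonal to X and J X. *)
Lemma hermitian_pair : exists X Y,
  [/\ r X X = 1, r Y Y = 1, r X Y = 0 & r (J *m X) Y = 0].
Proof.
have d0 : delta_mx 0 0 != 0 :> 'cV[R]_4.
  by apply/eqP => /matrixP /(_ 0 0); rewrite !mxE => /eqP; rewrite oner_eq0.
have [k XX] := normalize d0; move: (k *: _) XX => X XX.
pose P := X *m (X^T *m g) + (J *m X) *m ((J *m X)^T *m g).
have P1 : 1%:M - P != 0.
  apply/eqP => /eqP; rewrite subr_eq0 => /eqP E.
  (* Otherwise the identity of a 4-dimensional space would have rank at most 2. *)
have := mxrank1 R 4; rewrite E => rP.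
  have : (\rank P <= 1 + 1)%N.
    apply: leq_trans (mxrank_add _ _) _; apply: leq_add;
    by apply: leq_trans (mxrankM_maxl _ _) _; apply: rank_leq_col.
  by rewrite rP.
have [j Yj] : exists j, col j (1%:M - P) != 0.
  apply/existsP; apply: contraNT P1 => /existsPn H.
  apply/eqP/matrixP => i j; have /negPn/eqP/matrixP/(_ i 0) := H j.
  by rewrite !mxE.
have one Z W : r Z W = 1 -> Z^T *m g *m W = 1%:M.
  by move=> h; rewrite [LHS]mx11_scalar -[_ 0 0]/(r Z W) h.
have zero Z W : r Z W = 0 -> Z^T *m g *m W = 0.
  by move=> h; rewrite [LHS]mx11_scalar -[_ 0 0]/(r Z W) h raddf0.
have rXJX : r X (J *m X) = 0 by rewrite inner_acs inner_acs_diag oppr0.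
have rJXJX : r (J *m X) (J *m X) = 1 by rewrite inner_acs2.
have orth1 : r X (col j (1%:M - P)) = 0.
  rewrite colE /r mulmxA mulmxBr mulmx1 /P mulmxDr [X^T *m g *m (X *m _)]mulmxA.
  rewrite [X^T *m g *m (J *m X *m _)]mulmxA (one _ _ XX) (zero _ _ rXJX).
  by rewrite mul1mx mul0mx addr0 subrr mul0mx mxE.
have orth2 : r (J *m X) (col j (1%:M - P)) = 0.
  rewrite colE /r mulmxA mulmxBr mulmx1 /P mulmxDr [_ *m g *m (X *m _)]mulmxA.
  rewrite [_ *m g *m (J *m X *m _)]mulmxA (one _ _ rJXJX) (zero _ _ (inner_acs_diag X)).
  by rewrite mul1mx mul0mx add0r subrr mul0mx mxE.
have [l YY] := normalize Yj; exists X, (l *: col j (1%:M - P)).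
by rewrite YY XX !inner_scale orth1 orth2 mulr0.
Qed.

(** The factor makes real unit vectors go to unit vectors for the Hermitian
product. *)
Definition T10_part (X : 'cV[R]_4) : 'cV[C]_4 :=
  (Num.sqrt 2)^-1%:C *: (cplx_mx X + (- 'i%C) *: cplx_mx (J *m X)).

Lemma T10_part_T10 X : T10 J (T10_part X).
Proof.
rewrite /T10 /T10_part -scalemxAr [in RHS]scalerA [in RHS]mulrC -[in RHS]scalerA.
congr (_ *: _); rewrite mulmxDr -scalemxAr scalerDr scalerA mulrN sqr_iC opprK scale1r.
rewrite /cplx_mx -!map_mxM mulmxA Jsqr mulNmx mul1mx map_mxN scalerN scaleNr opprK.
by rewrite addrC.
Qed.

Lemma herm_T10_part X Y :
  herm g (T10_part X) (T10_part Y) = (r X Y)%:C - 'i%C * (r (J *m X) Y)%:C.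
Proof.
have bilr Z W : bil (cplx_mx g) (cplx_mx Z) (cplx_mx W) = (r Z W)%:C.
  by rewrite /bil /cplx_mx map_trmx -!map_mxM mxE.
have conj_cplx (Z : 'cV[R]_4) : conj_mx (cplx_mx Z) = cplx_mx Z.
  by apply/matrixP => i j; rewrite !mxE; exact: conjc_real.
rewrite -[LHS]/(bil _ _ (conj_mx _)) /T10_part conj_mxZ conj_mxD conj_mxZ !conj_cplx.
rewrite !(bilDl, bilDr, bilZl, bilZr) !bilr inner_acs2 inner_acs.
have -> : (- r (J *m X) Y)%:C = - (r (J *m X) Y)%:C :> C by rewrite rmorphN.
have -> : conjc (- 'i%C) = 'i%C :> C by apply/eqP; rewrite eq_complex /= oppr0 opprK !eqxx.
have -> : conjc (Num.sqrt 2)^-1%:C = (Num.sqrt 2)^-1%:C :> C by exact: conjc_real.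
have s2 : (Num.sqrt 2)^-1%:C * (Num.sqrt 2)^-1%:C = 2^-1 :> C.
  by rewrite -rmorphM -invfM -expr2 sqr_sqrtr ?ler0n // fmorphV rmorph_nat.
move: s2 (sqr_iC R); move: (Num.sqrt 2)^-1%:C ('i%C : C) => s w s2 w2.
move: (r X Y)%:C (r (J *m X) Y)%:C => a b.
transitivity (s * s * (a - w * w * a - 2 * w * b)); first by ring.
by rewrite s2 w2; field.
Qed.

Lemma unitary_frame_exists : exists z : 'I_2 -> 'cV[C]_4, unitary_frame g J z.
Proof.
have [X [Y [XX YY XY JXY]]] := hermitian_pair.
exists (fun a => if a == ord0 then T10_part X else T10_part Y).
split=> [a | a b]; first by case: ifP => _; apply: T10_part_T10.
have YX : r Y X = 0 by rewrite inner_sym.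
have JYX : r (J *m Y) X = 0 by rewrite inner_sym inner_acs JXY oppr0.
have ord2 (c : 'I_2) : c = ord0 \/ c = ord_max.
  by case: c => [[|[|//]] ci]; [left | right]; apply: val_inj.
by case: (ord2 a) => ->; case: (ord2 b) => -> /=;
  rewrite herm_T10_part ?XX ?YY ?XY ?YX ?JXY ?JYX ?inner_acs_diag ?mulr0 ?subr0.
Qed.

Lemma dual_coframe_exists (z : 'I_2 -> 'cV[C]_4) :
  unitary_frame g J z -> exists zeta, dual_coframe z zeta.
Proof.
move=> [z10 zz]; exists (fun a => (conj_mx (z a))^T *m cplx_mx g) => a b.
split.
  have -> : ((conj_mx (z a))^T *m cplx_mx g *m z b) 0 0 = herm g (z b) (z a).
    by rewrite -[LHS]/(bil _ _ _) -bil_tr (gCsym gsym).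
  by rewrite zz eq_sym.
rewrite -[LHS]/(bil _ _ _) -conj_bil.
by rewrite (T10_isotropic Jskew (z10 a) (z10 b)) conjc0.
Qed.

Lemma posdef_unitmx : g \in unitmx.
Proof.
rewrite -row_free_unit; apply: inj_row_free => v vg.
apply/eqP; apply: contraT => v0.
have vT0 : v^T != 0 by apply: contraNneq v0 => v0; rewrite -[v]trmxK v0 trmx0.
by have := gpos vT0; rewrite trmxK vg mul0mx mxE ltxx.
Qed.

End FrameExistence.

(** * The theorem *)

Section PointwiseEquivalence.
Variables (K : numFieldType) (L H : 'I_4 -> 'I_4 -> 'I_4 -> 'I_4 -> K).
Variable kap : 'I_4 -> 'I_4 -> K.
Hypothesis Lsym : riemann_symmetric L.
Hypothesis H02 : forall a b, H a b o0 o2 = L a b o0 o2 + kap a b.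
Hypothesis H13 : forall a b, H a b o1 o3 = L a b o1 o3 + kap a b.
Hypothesis H03 : forall a b, H a b o0 o3 = L a b o0 o3.
Hypothesis H12 : forall a b, H a b o1 o2 = L a b o1 o2.

(** Elementary linear algebra in the components [L] of the Riemann tensor and
[H] of the Hermitian curvature. Each pair of equations for constant curvature
splits: its difference is free of [kap] and is an equation on W^-, its sum is
an equation on the Ricci forms. *)
Lemma pointwise_equivalence :
  [/\ H o1 o3 o1 o3 = H o0 o2 o0 o2,
    H o0 o3 o0 o3 = 0 /\ H o1 o2 o1 o2 = 0,
    H o1 o2 o0 o2 + H o0 o2 o1 o2 = 0 /\ H o0 o3 o0 o2 + H o0 o2 o0 o3 = 0 &
    [/\ H o1 o3 o1 o2 + H o1 o2 o1 o3 = 0, H o1 o3 o0 o3 + H o0 o3 o1 o3 = 0 &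
    H o0 o2 o1 o3 + H o0 o3 o1 o2 + H o1 o2 o0 o3 + H o1 o3 o0 o2
      = 2 * H o0 o2 o0 o2]] <->
  [/\ L o0 o3 o0 o3 = 0, L o1 o2 o1 o2 = 0, L o0 o2 o0 o3 = L o0 o3 o1 o3,
      L o0 o2 o1 o2 = L o1 o2 o1 o3 &
      L o0 o2 o0 o2 + L o1 o3 o1 o3 - 2 * L o0 o2 o1 o3 = 2 * L o0 o3 o1 o2] /\
  [/\ H o1 o3 o1 o3 = H o0 o2 o0 o2,
      H o0 o3 o0 o2 + H o0 o3 o1 o3 + H o0 o2 o0 o3 + H o1 o3 o0 o3 = 0 &
      H o1 o2 o0 o2 + H o1 o2 o1 o3 + H o0 o2 o1 o2 + H o1 o3 o1 o2 = 0].
Proof.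
have [_ _ S _] := Lsym.
rewrite !H02 !H13 !H03 !H12.
rewrite (S o0 o2 o1 o2) (S o0 o2 o0 o3) (S o1 o2 o1 o3) (S o0 o3 o1 o3)
  (S o0 o3 o1 o2) (S o0 o2 o1 o3).
move: (L o0 o2 o0 o2) (L o1 o3 o1 o3) (L o0 o3 o0 o3) (L o1 o2 o1 o2) (L o0 o2 o1 o2)
  (L o0 o2 o0 o3) (L o1 o2 o1 o3) (L o0 o3 o1 o3) (L o0 o3 o1 o2) (L o0 o2 o1 o3)
  (kap o0 o2) (kap o1 o3) (kap o0 o3) (kap o1 o2).
move=> l0202 l1313 l0303 l1212 l0212 l0203 l1213 l0313 l0312 l0213 k02 k13 k03 k12.
have two0 : (2 : K) != 0 by rewrite pnatr_eq0.
have k13E : l1313 + k13 = l0202 + k02 -> k13 = l0202 + k02 - l1313.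
  by move=> <-; rewrite addrC addKr.
split=> [[/k13E -> [-> ->] [h5 h6] [h7 h8 h9]] | [[-> -> -> -> h5] [/k13E -> h6 h7]]].
  have k12E : k12 = - (2 * l0212) by apply: (addIr (2 * l0212)); rewrite addNr -h5; ring.
  have k03E : k03 = - (2 * l0203) by apply: (addIr (2 * l0203)); rewrite addNr -h6; ring.
  have e1 : l0203 = l0313.
    apply/esym/(mulfI two0)/eqP; rewrite -subr_eq0 -h8 k03E; apply/eqP; ring.
  have e2 : l0212 = l1213.
    apply/esym/(mulfI two0)/eqP; rewrite -subr_eq0 -h7 k12E; apply/eqP; ring.
  split; split=> //.
  - apply/eqP; rewrite -subr_eq0 -(subrr (2 * (l0202 + k02))) -{2}h9.
    by apply/eqP; ring.
  - by ring.
  - by rewrite k03E e1; ring.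
  - by rewrite k12E e2; ring.
have k12E : k12 = - (2 * l1213).
  by apply: (mulfI two0); apply/eqP; rewrite -subr_eq0 -h7; apply/eqP; ring.
have k03E : k03 = - (2 * l0313).
  by apply: (mulfI two0); apply/eqP; rewrite -subr_eq0 -h6; apply/eqP; ring.
rewrite k12E k03E; split=> //; [ring | split; ring | split; [ring | ring |]].
apply/eqP; rewrite -subr_eq0 -(subrr (2 * l0312)) -{2}h5.
by apply/eqP; ring.
Qed.

End PointwiseEquivalence.

Section PointTheorem.
Variables (R : realType).
Notation C := R[i].
Variables (g J : 'M[R]_4) (Rg Rn : 'I_4 -> 'I_4 -> 'I_4 -> 'I_4 -> R).
Variables (A N : 'I_4 -> 'M[R]_4) (D : 'I_4 -> 'I_4 -> 'M[R]_4).
Hypothesis gsym : g^T = g.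
Hypothesis gpos : forall X : 'cV[R]_4, X != 0 -> 0 < (X^T *m g *m X) 0 0.
Hypothesis Jsqr : J *m J = - 1%:M.
Hypothesis Jskew : J^T *m g = - (g *m J).
Hypothesis Rsym : riemann_symmetric Rg.
Hypothesis sA : forall i, skew_anticommuting g J (A i).
Hypothesis sN : forall i, skew_anticommuting g J (N i).
Hypothesis DJ : forall i j, D i j *m J + J *m D i j = - (A j *m N i + N i *m A j).
Hypothesis RnE : forall i j k l, Rn i j k l = Rg i j k l +
  (g *m (D i j - D j i + A i *m A j - A j *m A i)) l k.

Let T i j := D i j - D j i + A i *m A j - A j *m A i.

(** The scalar by which the curvature difference acts is imaginary and skew on
real vectors, so that its value [kap] on (z_1, conj z_1) is real. *)
Lemma hermitian_frame_components (z : 'I_2 -> 'cV[C]_4) : unitary_frame g J z ->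
  let L := frame_components (frame_of z) Rg in
  let H := frame_components (frame_of z) Rn in
  exists2 kap : 'I_4 -> 'I_4 -> C, conjc (kap o0 o2) = kap o0 o2 &
  forall a b, [/\ H a b o0 o2 = L a b o0 o2 + kap a b,
    H a b o1 o3 = L a b o1 o3 + kap a b, H a b o0 o3 = L a b o0 o3 &
    H a b o1 o2 = L a b o1 o2].
Proof.
move=> zU L H; have fz := frame_of_adapted gsym Jskew zU.
have sT := curvature_difference_scalar gsym Jskew fz (frame_of_conj z) sA sN DJ.
exists (fun a b => \sum_i \sum_j frame_of z a i 0 * frame_of z b j 0 *
  lowered g (frame_of z) (T i j) o2 o0).
  rewrite rmorph_sum exchange_big /=; apply: eq_bigr => j _.
  rewrite rmorph_sum; apply: eq_bigr => i _; rewrite !rmorphM.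
  rewrite [X in _ * X](sT j i).2; congr (_ * _).
  by rewrite /frame_of /= !mxE conjcK mulrC.
have HE a b c d : H a b c d = L a b c d + \sum_i \sum_j
    frame_of z a i 0 * frame_of z b j 0 * lowered g (frame_of z) (T i j) d c.
  rewrite /H /frame_components (eq_cplx_tensor _ _ _ _ RnE) cplx_tensorD.
  by congr (_ + _); apply: cplx_tensor_lowered.
move=> a b; rewrite !HE; split.
- by [].
- by congr (_ + _); apply: eq_bigr => i _; apply: eq_bigr => j _;
    have [[_ _ ->] _] := sT i j.
- rewrite !big1 ?addr0 // => i _; rewrite big1 // => j _.
  by have [[_ -> _] _] := sT i j; rewrite mulr0.
- rewrite !big1 ?addr0 // => i _; rewrite big1 // => j _.
  by have [[-> _ _] _] := sT i j; rewrite mulr0.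
Qed.

(** The three conditions become equations on frame components, with the same
unitary frame throughout. *)
Lemma frame_equivalence (z : 'I_2 -> 'cV[C]_4) (zeta : 'I_2 -> 'rV[C]_4) :
  unitary_frame g J z -> dual_coframe z zeta ->
  constant_hol_sec_curv g J Rn <->
  (forall i j k l, weyl_minus g J Rg i j k l = 0) /\
  hodge (cplx_mx g) (cplx_mx J) (ricci_rho Rn z zeta) = ricci_r Rn z zeta.
Proof.
move=> zU zD; have fz := frame_of_adapted gsym Jskew zU.
have Lsym := frame_components_riemann (frame_of z) Rsym.
have [kap kapR HL] := hermitian_frame_components zU.
have H02 a b := let: And4 h _ _ _ := HL a b in h.
have H13 a b := let: And4 _ h _ _ := HL a b in h.
have H03 a b := let: And4 _ _ h _ := HL a b in h.
have H12 a b := let: And4 _ _ _ h := HL a b in h.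
have PE := pointwise_equivalence Lsym H02 H13 H03 H12.
have WE := iff_trans (weyl_minus_eq0 gsym Jskew fz Rsym) (frame_weyl_eq0 Lsym).
have RE := hodge_ricciP Rn gsym Jskew zU zD.
have CE := constant_hol_sec_curvP Rn gsym Jskew zU.
rewrite WE RE -PE CE.
split=> [[k [h1 h2 h3 h5 [h7 h8 h9]]] | [h2 h3 h5 [h7 h8 h9]]].
  by rewrite h1 h2.
have [k Hk] : exists k : R, frame_components (frame_of z) Rn o0 o2 o0 o2 = k%:C.
  have [S1 S2 _ _] := Lsym.
  have real_conj (w : C) : conjc w = w -> exists k : R, w = k%:C.
    case: w => a b /eqP; rewrite eq_complex /= => /andP[_]; rewrite eqNr => /eqP ->.
    by exists a.
  apply: real_conj; rewrite H02 rmorphD [X in _ + X]kapR; congr (_ + _).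
  rewrite [LHS]cplx_tensor_conj !frame_of_conj.
  by rewrite -[LHS]/(frame_components (frame_of z) Rg o2 o0 o2 o0) S1 S2 opprK.
by exists k; rewrite h2 h9 Hk.
Qed.

End PointTheorem.

Theorem theorem1p3 (R : realType) (M : smooth_manifold R 4)
    (S : almost_hermitian M) (p : M) (c : chart M) (hp : chart_dom c p) :
  let x := chart_map c p in
  let g := metric S c in
  let J := acs S c in
  let Rg := curvature_tensor (levi_civita g) g x in
  let Rnabla := curvature_tensor (hermitian_connection g J) g x in
  constant_hol_sec_curv (g x) (J x) Rnabla <->
  (forall i j k l : 'I_4, weyl_minus (g x) (J x) Rg i j k l = 0) /\
  (forall (z : 'I_2 -> 'cV[R[i]]_4) (zeta : 'I_2 -> 'rV[R[i]]_4),
     unitary_frame (g x) (J x) z -> dual_coframe z zeta ->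
     hodge (cplx_mx (g x)) (cplx_mx (J x)) (ricci_rho Rnabla z zeta)
     = ricci_r Rnabla z zeta).
Proof.
move=> x g J Rg Rnabla.
pose U : set 'cV[R]_4 := [set chart_map c q | q in chart_dom c].
have Ux : U x by exists p.
have oU : open U by apply: chart_image_open.
have gsm : smooth_mx_on U g by apply: metric_smooth.
have Jsm : smooth_mx_on U J by apply: acs_smooth.
have gsym y : U y -> (g y)^T = g y by move=> [q hq <-]; apply: Defs.metric_sym.
have gpos y : U y -> forall X : 'cV[R]_4, X != 0 -> 0 < (X^T *m g y *m X) 0 0.
  by move=> [q hq <-] X X0; apply: Defs.metric_pos.
have Jsqr y : U y -> J y *m J y = - 1%:M by move=> [q hq <-]; apply: acs_sqr.
have Jorth y : U y -> (J y)^T *m g y *m J y = g y.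
  by move=> [q hq <-]; apply: acs_orthogonal.
have gunit y : U y -> g y \in unitmx by move=> Uy; apply: posdef_unitmx (gpos y Uy).
have Jskew : (J x)^T *m g x = - (g x *m J x) := acs_skew Jsqr Jorth Ux.
have equiv := frame_equivalence (gsym x Ux) Jskew
  (levi_civita_riemann_symmetric oU gsm gsym gunit Ux)
  (fun i => contorsion_skew oU gsm Jsm gsym gunit Jsqr Jorth i Ux)
  (fun i => covariant_acs_skew oU gsm Jsm gsym gunit Jsqr Jorth i Ux)
  (fun i j => covariant_contorsion_acs oU gsm Jsm gsym gunit Jsqr Jorth i j Ux)
  (fun i j k l => hermitian_curvatureE oU gsm Jsm gsym gunit i j k l Ux).
have [z zU] := unitary_frame_exists (gsym x Ux) (gpos x Ux) (Jsqr x Ux) Jskew.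
have [zeta zD] := dual_coframe_exists (gsym x Ux) Jskew zU.
split=> [H | [W0 rho_r]]; last by apply/(equiv z zeta zU zD); split=> //; apply: rho_r.
split; first by have [] := (equiv z zeta zU zD).1 H.
by move=> z' zeta' zU' zD'; have [_] := (equiv z' zeta' zU' zD').1 H.
Qed.
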